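(* Let $\mathcal{O}$ be a complete discrete valuation ring with maximal ideal $\mathfrak{p}$ and finite residue field $k=\mathcal{O}/\mathfrak{p}$, and let $K$ be its field of fractions. Let $E$ be a finite étale $K$-algebra with a $\Lambda_{\mathcal{O}}$-structure, and let $S=\mathrm{Hom}_{K\text{-alg}}(E,K^{\mathrm{sep}})$ with its induced action of $I(\mathcal{O})\times G_K$. Then $E$ has an integral $\Lambda_{\mathcal{O}}$-model if and only if the following two conditions hold: (1) the inertia group $I_K$ acts trivially on $S_{\mathrm{unr}}=\bigcap_{\mathfrak{a}\in I(\mathcal{O})}\mathfrak{a}S$; (2) the element $\mathfrak{p}\in I(\mathcal{O})$ and the Frobenius element $F\in G_K/I_K$ act in the same way on $S_{\mathrm{unr}}$.
   Context: For a torsion-free commutative $\mathcal{O}$-algebra $R$ ($\mathcal{O}$ a Dedekind domain with finite residue fields, set of maximal ideals $\mathcal{M}$), a Frobenius lift at $\mathfrak{q}\in\mathcal{M}$ is an $\mathcal{O}$-algebra endomorphism $\psi$ of $R$ such that $\psi\otimes_{\mathcal{O}}\mathcal{O}/\mathfrak{q}$ is the map $x\mapsto x^{\#(\mathcal{O}/\mathfrak{q})}$ on $R/\mathfrak{q}R$. A $\Lambda_{\mathcal{O}}$-structure on $R$ is a map $\mathcal{M}\to\mathrm{End}_{\mathcal{O}\text{-alg}}(R)$, $\mathfrak{q}\mapsto\psi_{\mathfrak{q}}$, such that each $\psi_{\mathfrak{q}}$ is a Frobenius lift at $\mathfrak{q}$ and $\psi_{\mathfrak{q}}\psi_{\mathfrak{q}'}=\psi_{\mathfrak{q}'}\psi_{\mathfrak{q}}$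 for all $\mathfrak{q},\mathfrak{q}'$; a $\Lambda_{\mathcal{O}}$-ring is a torsion-free $\mathcal{O}$-algebra with a $\Lambda_{\mathcal{O}}$-structure. (Here $\mathcal{M}=\{\mathfrak{p}\}$.) An integral $\Lambda_{\mathcal{O}}$-model of a $\Lambda_{\mathcal{O}}$-ring $E$ that is a finite étale $K$-algebra is an $\mathcal{O}$-subalgebra $A\subseteq E$ which is finite flat as an $\mathcal{O}$-module, spans $E$ over $K$ ($A\otimes_{\mathcal{O}}K=E$), and is stable under all $\psi_{\mathfrak{q}}$ with the restrictions forming a $\Lambda_{\mathcal{O}}$-structure on $A$. $I(\mathcal{O})$ denotes the monoid of nonzero ideals of $\mathcal{O}$ under multiplication (free commutative on $\mathcal{M}$). $K^{\mathrm{sep}}$ is a separable closure of $K$, $G_K=\mathrm{Gal}(K^{\mathrm{sep}}/K)$, $I_K\subseteq G_K$ the inertia subgroup, and $F\in G_K/I_K$ (the absolute Galois group of $k$) the Frobenius $x\mapsto x^{\#k}$; $F$ acts on any $G_K$-set on which $I_K$ acts trivially. $G_K$ acts on $S$ by $s\mapsto\sigma\circ s$, and $I(\mathcal{O})$ acts on $S$ via the monoid map sending $\mathfrak{q}\in\mathcal{M}$ to $s\mapsto s\circ\psi_{\mathfrak{q}}$; these actions commute. For $\mathfrak{a}\in I(\mathcal{O})$, $\mathfrak{a}S$ denotes the image of $S$ under the action of $\mathfrak{a}$. *)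

(* Defs.v *)
(* MathComp, with the Prop-valued sets [set T] of mathcomp-classical.
   All rings are commutative.  An algebra over R is a ring together with a
   structure morphism from R; its carrier is a comPzRingType, so that the zero
   algebra (which is finite étale) is allowed. *)
From HB Require Import structures.
From mathcomp Require Import all_boot all_order all_algebra all_field.
From mathcomp Require Import boolp classical_sets.

Set Implicit Arguments.
Unset Strict Implicit.
Unset Printing Implicit Defensive.

Import GRing.Theory.
Local Open Scope ring_scope.
Local Open Scope classical_set_scope.

Section Ideals.
Variable R : comNzRingType.
Implicit Types (a b p : set R).

Definition is_ideal a :=
  [/\ a 0, forall x y, a x -> a y -> a (x + y) & forall c x, a x -> a (c * x)].

Definition principal (g : R) : set R := [set x | exists c, x = c * g].

Definition ideal_mul a b : set R :=
  [set x | exists n (u v : 'I_n -> R),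
     [/\ forall i, a (u i), forall i, b (v i) & x = \sum_i u i * v i]].

Definition ideal_exp a n : set R := iter n (ideal_mul a) setT.

Definition is_maximal_ideal a :=
  [/\ is_ideal a, ~ a 1 &
      forall b, is_ideal b -> ~ b 1 -> a `<=` b -> a = b].

(* The monoid I(R). *)
Definition nonzero_ideal : set (set R) :=
  [set a | is_ideal a /\ a <> [set 0]].

(* R -> lim_n R/p^n is bijective. *)
Definition adically_complete p :=
  forall x : nat -> R,
    (forall n, ideal_exp p n (x n.+1 - x n)) ->
    exists! l, forall n, ideal_exp p n (l - x n).

End Ideals.

(* Local principal ideal domain that is not a field. *)
Definition is_dvr (O : idomainType) (p : set O) :=
  [/\ forall a : set O, is_ideal a -> exists g, a = principal g,
      forall q : set O, is_maximal_ideal q <-> q = p &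
      p <> [set 0]].

Definition is_residue_map (O : idomainType) (p : set O) (k : finFieldType)
    (rho : {rmorphism O -> k}) :=
  (forall y, exists c, rho c = y) /\ (forall c, p c <-> rho c = 0).

Definition is_fraction_field (O : idomainType) (K : fieldType)
    (iota : {rmorphism O -> K}) :=
  injective iota /\
  (forall x, exists c d, d != 0 /\ x = iota c / iota d).

Definition is_separable_closure (K Ksep : fieldType)
    (j : {rmorphism K -> Ksep}) :=
  (forall x, exists2 q : {poly K}, separable_poly q & root (map_poly j q) x) /\
  (forall q : {poly Ksep},
     separable_poly q -> (1 < size q)%N -> exists x, root q x).

(* E is K-isomorphic to a finite product of finite separable extensions of K. *)
Definition finite_etale (K : fieldType) (E : comPzRingType)
    (eta : {rmorphism K -> E}) :=
  exists (n : nat) (L : 'I_n -> fieldExtType K)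
         (pr : forall i, {rmorphism E -> L i}),
    [/\ forall i, separable 1%VS {:L i}%VS,
        forall i a, pr i (eta a) = a%:A &
        forall y : (forall i, L i), exists! x, forall i, pr i x = y i].

Section Algebras.
Variables (O : idomainType) (R : comPzRingType) (f : {rmorphism O -> R}).
Implicit Types (A : set R) (p : set O).

Definition subalgebra A :=
  [/\ A 1, forall x y, A x -> A y -> A (x - y),
      forall x y, A x -> A y -> A (x * y) &
      forall c x, A x -> A (f c * x)].

Definition finite_module A :=
  exists n (e : 'I_n -> R), (forall i, A (e i)) /\
    forall x, A x -> exists c : 'I_n -> O, x = \sum_i f (c i) * e i.

Definition bilinear_on A (N P : lmodType O) (b : N -> R -> P) :=
  (forall m, A m -> forall c x y, b (c *: x + y) m = c *: b x m + b y m) /\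
  (forall x c m m', A m -> A m' ->
     b x (f c * m + m') = c *: b x m + b x m').

(* \sum_i x_i (x) m_i = 0 in the tensor product of N and A over O, expressed
   by its universal property. *)
Definition tensor_zero A (N : lmodType O) n (x : 'I_n -> N) (m : 'I_n -> R) :=
  forall (P : lmodType O) (b : N -> R -> P),
    bilinear_on A b -> \sum_i b (x i) (m i) = 0.

(* Tensoring with A preserves injectivity. *)
Definition flat_module A :=
  forall (N' N : lmodType O) (g : {linear N' -> N}), injective g ->
  forall n (x : 'I_n -> N') (m : 'I_n -> R), (forall i, A (m i)) ->
    tensor_zero A (fun i => g (x i)) m -> tensor_zero A x m.

Definition torsion_free A :=
  forall c x, A x -> c != 0 -> f c * x = 0 -> x = 0.

(* The ideal pA of A. *)
Definition ext_ideal p A : set R :=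
  [set x | exists n (c : 'I_n -> O) (e : 'I_n -> R),
     [/\ forall i, p (c i), forall i, A (e i) & x = \sum_i f (c i) * e i]].

(* For O with the single maximal ideal p and #(O/p) = q: psi maps the
   subalgebra A to itself, and its restriction makes A a Lambda_O-ring.  For a
   single maximal ideal the commutation condition is empty. *)
Definition lambda_structure p (q : nat) A (psi : {rmorphism R -> R}) :=
  [/\ torsion_free A,
      forall x, A x -> A (psi x),
      forall c x, A x -> psi (f c * x) = f c * psi x &
      forall x, A x -> ext_ideal p A (psi x - x ^+ q)].

End Algebras.

(* A is an integral Lambda_O-model of the K-algebra (E, eta). *)
Definition integral_lambda_model (O : idomainType) (p : set O) (q : nat)
    (K : fieldType) (iota : {rmorphism O -> K})
    (E : comPzRingType) (eta : {rmorphism K -> E})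
    (psi : {rmorphism E -> E}) (A : set E) :=
  let f : {rmorphism O -> E} := eta \o iota in
  [/\ subalgebra f A,
      finite_module f A /\ flat_module f A,
      forall x, exists n (a : 'I_n -> K) (e : 'I_n -> E),
        (forall i, A (e i)) /\ x = \sum_i eta (a i) * e i &
      lambda_structure f p q A psi].

Section Galois.
Variables (O : idomainType) (K Ksep : fieldType).
Variables (iota : {rmorphism O -> K}) (j : {rmorphism K -> Ksep}).

(* Ksep / K is algebraic, hence G_K = Aut(Ksep / K). *)
Definition galois_elt (sigma : {rmorphism Ksep -> Ksep}) :=
  bijective sigma /\ forall a, sigma (j a) = j a.

Definition sep_integral (x : Ksep) : Prop := integralOver (j \o iota) x.

(* Non-units of the integral closure of O in Ksep.  For O complete this
   closure is a local ring, and they form its maximal ideal. *)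
Definition sep_max (x : Ksep) : Prop :=
  sep_integral x /\ forall y, sep_integral y -> x * y != 1.

Definition inertia_elt (sigma : {rmorphism Ksep -> Ksep}) :=
  galois_elt sigma /\ forall x, sep_integral x -> sep_max (sigma x - x).

(* The elements of the coset F in G_K / I_K. *)
Definition frobenius_elt (q : nat) (sigma : {rmorphism Ksep -> Ksep}) :=
  galois_elt sigma /\ forall x, sep_integral x -> sep_max (sigma x - x ^+ q).

End Galois.

Section Points.
Variables (O : idomainType) (p : set O) (K Ksep : fieldType).
Variables (j : {rmorphism K -> Ksep}).
Variables (E : comPzRingType) (eta : {rmorphism K -> E}).
Variable psi : {rmorphism E -> E}.

Definition points : set {rmorphism E -> Ksep} :=
  [set s | forall a, s (eta a) = j a].

(* The ideal a sends s to s'.  I(O) is free on p, so a = p^n for a unique n,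
   and p^n acts by precomposition with the n-th iterate of psi. *)
Definition ideal_acts (a : set O) (s s' : {rmorphism E -> Ksep}) :=
  exists2 n, a = ideal_exp p n & s' =1 s \o iter n psi.

Definition ideal_image (a : set O) : set {rmorphism E -> Ksep} :=
  [set s' | points s' /\ exists2 s, points s & ideal_acts a s s'].

Definition points_unr : set {rmorphism E -> Ksep} :=
  \bigcap_(a in @nonzero_ideal O) ideal_image a.

End Points.

(* Main.v *)
(** Let [pi] be a uniformizer, [q = #|k|], and let [psi^N] be an idempotent
    power of [psi]; a point [s] lies in [S_unr] exactly when
    [s \o psi^N = s].

    If a model [A] exists and two such points are congruent on [A] modulo the
    maximal ideal of the integral closure of [O], then their difference [d]
    satisfies: [d (psi x)] is a combination of values of [d] with coefficients
    in the maximal ideal.  Periodicity and Nakayama's lemma give [d = 0].  This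
    applies to [sigma \o s] and [s] for [sigma] in the inertia group, and to
    [sigma \o s] and [s \o psi] for a Frobenius element [sigma].

    Conversely, the fixed field of inertia is generated over [K] by the
    Teichmueller elements [z], [z^(q^t) = z], on which Frobenius is the [q]-th
    power map; so under (1) and (2) there is one such [z] with
    [s (psi^N x) = h(z)] and [s (psi^N (psi x)) = h(z^q)], [h] in [K[X]], for
    all points [s].  With a large enough finite [O]-subalgebra [C] of [Ksep],
    the set of [x] such that [s (psi^N x)] is in [O[z]] and
    [s (psi^n (x - psi^N x))] is in [pi^(n+1) C] for all [n] and [s] is a
    model. *)
Require Import Defs.
From HB Require Import structures.
From mathcomp Require Import all_boot all_order all_algebra all_field.
From mathcomp Require Import cyclic ring zify.
From mathcomp Require Import boolp classical_sets.
Set Implicit Arguments.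
Unset Strict Implicit.
Unset Printing Implicit Defensive.
Import GRing.Theory.
Local Open Scope ring_scope.
Local Open Scope classical_set_scope.

(** The integral closure of [O] in [Ksep] is not a finite [O]-module, while completeness is
    exploited in finite modules, where limits are computed on coefficients. Every limit is therefore
    taken in a finite subalgebra generated by the few integral elements at hand. This shows that the
    non-units of the integral closure form a prime ideal, and that some q^i-th power of any integral
    element is congruent modulo [pi] to a Teichmueller element. Congruence modulo the non-units then
    plays the part of equality in the residue field of [Ksep].

    The obstacle in building a model is that psi x - x^q must be divisible by [pi] inside the model
    itself. On the part killed by a power of [psi], dividing by [pi] costs one exponent. The term
    psi x wins it back because the exponent grows with n, and the term x^q because q-th powers
    sharpen a congruence by one exponent. The latter holds only from exponent 1 on, hence n+1 and
    not n. On the periodic part, O[z] serves because h(z^q) and h(z)^q agree modulo pi O[z] by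
    direct expansion. *)

(** * Complete discrete valuation rings through a uniformizer *)

Record complete_dvr (O : idomainType) (k : finFieldType)
    (rho : {rmorphism O -> k}) (pi : O) : Prop := CompleteDvr {
  uniformizer_neq0 : pi != 0;
  residue_surj : forall y, exists c, rho c = y;
  residue_ker : forall c, rho c = 0 <-> exists d, c = pi * d;
  adic_separated : forall c, (forall n, exists d, c = pi ^+ n * d) -> c = 0;
  adic_lim : forall x : nat -> O,
    (forall n, exists d, x n.+1 - x n = pi ^+ n * d) ->
    exists l, forall n, exists d, l - x n = pi ^+ n * d }.

Lemma principal_ideal (R : comNzRingType) (g : R) : is_ideal (principal g).
Proof.
split; first by exists 0; rewrite mul0r.
  by move=> _ _ [c ->] [d ->]; exists (c + d); rewrite mulrDl.
by move=> c _ [d ->]; exists (c * d); rewrite mulrA.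
Qed.

Lemma ideal_mul_principal (R : comNzRingType) (g h : R) :
  ideal_mul (principal g) (principal h) = principal (g * h).
Proof.
apply/seteqP; split=> x /=.
  case=> n [u [v [Hu Hv ->]]].
  have [I0 ID IM] := principal_ideal (g * h).
  apply: (big_ind (principal (g * h))) => // i _.
  case: (Hu i) (Hv i) => [c ->] [d ->].
  by exists (c * d); rewrite mulrACA.
case=> c ->; exists 1%N, (fun=> c * g), (fun=> h); split.
- by move=> _; exists c.
- by move=> _; exists 1; rewrite mul1r.
- by rewrite big_ord1 mulrA.
Qed.

Lemma ideal_exp_principal (R : comNzRingType) (g : R) n :
  ideal_exp (principal g) n = principal (g ^+ n).
Proof.
elim: n => [|n IHn].
  apply/seteqP; split=> x //= _.
  by exists x; rewrite expr0 mulr1.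
by rewrite /ideal_exp iterS -/(ideal_exp _ n) IHn ideal_mul_principal -exprS.
Qed.

Lemma dvr_uniformizer (O : idomainType) (p : set O) (k : finFieldType)
    (rho : {rmorphism O -> k}) :
    is_dvr p -> adically_complete p -> is_residue_map p rho ->
  exists2 pi, p = principal pi & complete_dvr rho pi.
Proof.
move=> [pid maxp p_neq0] compl [rho_surj rho_ker].
have [p_ideal _ _] : is_maximal_ideal p by apply/maxp.
have [pi def_p] := pid p p_ideal.
have expE n x : ideal_exp p n x <-> exists d, x = pi ^+ n * d.
  rewrite def_p ideal_exp_principal; split=> -[d ->]; exists d;
  by rewrite mulrC.
exists pi => //; split.
- apply/eqP => pi0; apply: p_neq0; rewrite def_p pi0.
  apply/seteqP; split=> x /=; first by case=> c ->; rewrite mulr0.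
  by move->; exists 0; rewrite mul0r.
- exact: rho_surj.
- move=> c; rewrite -rho_ker def_p.
  by split=> -[d ->]; exists d; rewrite mulrC.
- move=> c c_div.
  (* Separatedness is the uniqueness of limits: [c] and 0 are both limits of the zero sequence. *)
  have [|l [_ l_uniq]] := compl (fun=> 0).
    by move=> n; apply/expE; exists 0; rewrite mulr0 subr0.
  rewrite -(l_uniq c) ?(l_uniq 0) // => n; apply/expE; rewrite subr0 //.
  by exists 0; rewrite mulr0.
- move=> x x_cauchy.
  have [|l [l_lim _]] := compl x.
    by move=> n; apply/expE.
  by exists l => n; apply/expE.
Qed.

Section CompleteDvr.
Variables (O : idomainType) (k : finFieldType) (rho : {rmorphism O -> k}).
Variable pi : O.
Hypothesis dvrO : complete_dvr rho pi.
Local Notation q := #|k|.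

Lemma residue_uniformizer : rho pi = 0.
Proof. by apply/(residue_ker dvrO); exists 1; rewrite mulr1. Qed.

(** An inverse [d] modulo [pi] gives c d = 1 - pi t, which is inverted by the geometric series in pi
    t, convergent by completeness. *)
Lemma residue_unit c : rho c != 0 -> c \is a GRing.unit.
Proof.
move=> rho_c; have [d rho_d] := residue_surj dvrO (rho c)^-1.
have [t def_t] : exists t, 1 - c * d = pi * t.
  by apply/(residue_ker dvrO); rewrite rmorphB rmorphM rmorph1 rho_d divff ?subrr.
have [|l l_lim] := adic_lim dvrO (x := fun n => \sum_(i < n) (pi * t) ^+ i).
  move=> n; exists (t ^+ n).
  by rewrite big_ord_recr /= addrAC subrr add0r exprMn.
suff : c * d * l - 1 = 0.
  by move/subr0_eq => cdl; apply/unitrPr; exists (d * l); rewrite mulrA.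
apply: (adic_separated dvrO) => n; have [e def_e] := l_lim n.
exists (c * d * e - t ^+ n); rewrite mulrBr -exprMn mulrCA -def_e.
have -> : c * d = 1 - pi * t by rewrite -def_t opprB addrC subrK.
have := subrXX 1 (pi * t) n; rewrite expr1n => E.
have {E} -> : (pi * t) ^+ n = 1 - (1 - pi * t) * \sum_(i < n) (pi * t) ^+ i.
  rewrite (eq_bigr (fun i : 'I_n => 1 ^+ (n.-1 - i) * (pi * t) ^+ i)).
    by rewrite -E opprB addrC subrK.
  by move=> i _; rewrite expr1n mul1r.
ring.
Qed.

Lemma residue_neq0 c : reflect (exists d, c = pi * d) (rho c == 0).
Proof. by apply: (iffP eqP) => /(residue_ker dvrO). Qed.

Lemma factor_uniformizer c :
  c != 0 -> exists n u, u \is a GRing.unit /\ c = pi ^+ n * u.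
Proof.
move=> c0.
have [n n_ndiv] : exists n, ~ exists d, c = pi ^+ n * d.
  by apply/existsNP => c_div; case/eqP: c0; apply: (adic_separated dvrO).
elim: n => [|n IHn] in n_ndiv *.
  by case: n_ndiv; exists c; rewrite mul1r.
have [[d def_d]|] := pselect (exists d, c = pi ^+ n * d); last exact: IHn.
exists n, d; split=> //; apply: residue_unit.
apply/negP => /residue_neq0[e def_e]; apply: n_ndiv.
by exists e; rewrite exprSr -mulrA -def_e.
Qed.

(** The alternatives are asymmetric on purpose: the factor [pi] makes the second divisibility
    strict, and [integrally_closed] relies on it. *)
Lemma uniformizer_dvd_total c d :
  (exists e, c = d * e) \/ (exists e, d = c * (pi * e)).
Proof.
have [->|c0] := eqVneq c 0; first by left; exists 0; rewrite mulr0.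
have [->|d0] := eqVneq d 0; first by right; exists 0; rewrite !mulr0.
have [m [u [u_unit ->]]] := factor_uniformizer c0.
have [n [v [v_unit ->]]] := factor_uniformizer d0.
case: (leqP n m) => le_mn; [left | right].
  exists (pi ^+ (m - n) * (v^-1 * u)).
  by rewrite mulrACA -exprD subnKC // mulVKr.
exists (pi ^+ (n - m).-1 * (u^-1 * v)).
rewrite [pi * _]mulrA -exprS prednK ?subn_gt0 //.
by rewrite mulrACA -exprD subnKC 1?ltnW // mulVKr.
Qed.

Lemma uniformizer_exp_inj m n u :
  pi ^+ m = pi ^+ n * u -> (n <= m)%N.
Proof.
rewrite leqNgt => pi_mn; apply/negP => lt_mn.
have := pi_mn; rewrite -(subnKC (ltnW lt_mn)) exprD -mulrA -{1}[pi ^+ m]mulr1.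
have pim0 : pi ^+ m != 0 by rewrite expf_neq0 ?(uniformizer_neq0 dvrO).
move/(mulfI pim0)/(congr1 rho)/eqP.
rewrite rmorph1 rmorphM rmorphXn residue_uniformizer expr0n.
by rewrite gtn_eqF ?subn_gt0 // mul0r oner_eq0.
Qed.

Lemma residue_pnat_card : [pchar k].-nat q.
Proof.
have [p p_pr p_pchar] := finPcharP k.
rewrite (card_pprimeChar p_pchar) (eq_pnat _ (pcharf_eq p_pchar)).
by rewrite pnatX pnat_id.
Qed.

Lemma residue_expr_card c : exists d, c ^+ q = c + pi * d.
Proof.
have [|d def_d] := residue_neq0 (c ^+ q - c) _.
  by rewrite rmorphB rmorphXn expf_card subrr.
by exists d; rewrite -def_d addrC subrK.
Qed.

(** Since [q] is a power of the characteristic of [k], one has (X + 1)^q = X^q + 1 over [k]; the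
    middle coefficients vanish there. *)
Lemma residue_bin i : (0 < i < q)%N -> exists d, 'C(q, i)%:R = pi * d.
Proof.
case/andP=> i_gt0 ltiq; apply/residue_neq0; rewrite rmorph_nat.
have : ('X + 1) ^+ q = 'X^q + 1 :> {poly k}.
  rewrite exprDn_pchar ?expr1n // (eq_pnat _ (pchar_poly _)).
  exact: residue_pnat_card.
move/(congr1 (fun f : {poly k} => f`_i)); rewrite exprD1n coef_sum.
rewrite (bigD1 (Ordinal (leqW ltiq))) //= big1 => [|j].
  rewrite addr0 coefD coefMn coefXn coef1 coefXn eqxx.
  by rewrite (ltn_eqF ltiq) gtn_eqF // addr0 => ->.
rewrite -val_eqE /= coefMn coefXn eq_sym => /negPf->.
by rewrite mul0rn.
Qed.

End CompleteDvr.

(** * The pi-adic filtration of a finite subalgebra *)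

Section Subalgebra.
Variables (O : idomainType) (R : comPzRingType) (f : {rmorphism O -> R}).
Variable B : set R.
Hypothesis saB : subalgebra f B.

Lemma sa1 : B 1. Proof. by case: saB. Qed.
Lemma sa_sub x y : B x -> B y -> B (x - y). Proof. by case: saB => _ H _ _; apply: H. Qed.
Lemma sa_mul x y : B x -> B y -> B (x * y). Proof. by case: saB => _ _ H _; apply: H. Qed.
Lemma sa_scale c x : B x -> B (f c * x). Proof. by case: saB => _ _ _ H; apply: H. Qed.
Lemma sa0 : B 0. Proof. by rewrite -(subrr 1); apply: sa_sub; exact: sa1. Qed.
Lemma sa_opp x : B x -> B (- x).
Proof. by rewrite -sub0r; apply: sa_sub; exact: sa0. Qed.
Lemma sa_add x y : B x -> B y -> B (x + y).
Proof. by move=> Bx By; rewrite -[y]opprK; apply: sa_sub => //; apply: sa_opp. Qed.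
Lemma sa_const c : B (f c).
Proof. by rewrite -[f c]mulr1; apply: sa_scale; exact: sa1. Qed.
Lemma sa_exp x n : B x -> B (x ^+ n).
Proof.
by move=> Bx; elim: n => [|n IHn]; rewrite ?expr0 ?exprS;
  [exact: sa1 | exact: sa_mul].
Qed.
Lemma sa_sum (I : Type) (r : seq I) (P : pred I) (F : I -> R) :
  (forall i, P i -> B (F i)) -> B (\sum_(i <- r | P i) F i).
Proof. by move=> BF; apply: (big_ind B) => //; [exact: sa0 | exact: sa_add]. Qed.

Variable pi : O.

(** The ideal pi^n B; the congruence of x and y modulo it is written [adic n (x - y)]. *)
Definition adic n : set R := [set x | exists2 b, B b & x = f pi ^+ n * b].

Lemma adic0 n : adic n 0. Proof. by exists 0; rewrite ?mulr0 //; exact: sa0. Qed.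

Lemma adicD n x y : adic n x -> adic n y -> adic n (x + y).
Proof.
move=> [b Bb ->] [c Bc ->]; exists (b + c); rewrite ?mulrDr //; exact: sa_add.
Qed.

Lemma adicN n x : adic n x -> adic n (- x).
Proof. by move=> [b Bb ->]; exists (- b); rewrite ?mulrN //; exact: sa_opp. Qed.

Lemma adicB n x y : adic n x -> adic n y -> adic n (x - y).
Proof. by move=> ax ay; apply: adicD => //; apply: adicN. Qed.

Lemma adic_trans n y x z : adic n (x - y) -> adic n (y - z) -> adic n (x - z).
Proof. by move=> xy yz; rewrite -(subrKA y x (- z)); apply: adicD. Qed.

Lemma adicC n x y : adic n (x - y) -> adic n (y - x).
Proof. by rewrite -[y - x]opprB; exact: adicN. Qed.

Lemma adicM m n x y : adic m x -> adic n y -> adic (m + n) (x * y).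
Proof.
move=> [b Bb ->] [c Bc ->]; exists (b * c); first exact: sa_mul.
by rewrite exprD mulrACA.
Qed.

Lemma adic_zero x : B x -> adic 0 x.
Proof. by move=> Bx; exists x; rewrite ?mul1r. Qed.

Lemma adicMl n b x : B b -> adic n x -> adic n (b * x).
Proof. by move=> /adic_zero; exact: adicM. Qed.

Lemma adicMr n x b : B b -> adic n x -> adic n (x * b).
Proof. by rewrite mulrC; exact: adicMl. Qed.

Lemma adicW m n x : (m <= n)%N -> adic n x -> adic m x.
Proof.
move=> le_mn [b Bb ->]; exists (f pi ^+ (n - m) * b).
  by apply: sa_mul => //; apply: sa_exp; exact: sa_const.
by rewrite mulrA -exprD subnKC.
Qed.

Lemma adic_sub n x : adic n x -> B x.
Proof. by move/(adicW (leq0n n)) => [b Bb ->]; rewrite mul1r. Qed.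

Lemma adicX m x n : adic m x -> adic (m * n) (x ^+ n).
Proof.
move=> ax; elim: n => [|n IHn]; first by rewrite muln0; apply: adic_zero; exact: sa1.
by rewrite exprS mulnS; apply: adicM.
Qed.

Lemma adic_uniformizer n b : B b -> adic n (f pi ^+ n * b).
Proof. by exists b. Qed.

Lemma adicS n x : adic n x -> adic n.+1 (f pi * x).
Proof. by move=> [b Bb ->]; exists b; rewrite // mulrA exprS. Qed.

Lemma adic_lincomb n m (c : 'I_m -> O) (e : 'I_m -> R) :
    (forall i, B (e i)) -> (forall i, exists d, c i = pi ^+ n * d) ->
  adic n (\sum_i f (c i) * e i).
Proof.
move=> Be c_div; apply: (big_ind (adic n)) => [||i _]; first exact: adic0.
  exact: adicD.
have [d ->] := c_div i; exists (f d * e i); first exact: sa_scale.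
by rewrite rmorphM rmorphXn mulrA.
Qed.

Variables (k : finFieldType) (rho : {rmorphism O -> k}).
Hypothesis dvrO : complete_dvr rho pi.
Local Notation q := #|k|.

(** Each middle binomial term contains both [pi], from the binomial coefficient, and [y]. The factor
    [y] is kept in the error term because it carries the extra exponent in [adic_expr_card]. *)
Lemma exprD_card x y : B x -> B y ->
  exists2 z, B z & (x + y) ^+ q = x ^+ q + y ^+ q + f pi * (y * z).
Proof.
move=> Bx By.
suff [z Bz Ez] : exists2 z, B z &
    (x + y) ^+ q - x ^+ q - y ^+ q = f pi * (y * z).
  by exists z; rewrite // -Ez; ring.
have q_gt0 : (0 < q)%N by apply: ltnW; exact: finNzRing_gt1.
rewrite exprDn -(prednK q_gt0) big_ord_recl big_ord_recr /=.
rewrite bin0 mulr1n expr0 mulr1 /bump /= subnn binn mulr1n expr0 mul1r.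
rewrite subn0 add1n; set S := \sum_(i < _) _.
have -> : forall u v : R, u + (S + v) - u - v = S by move=> u v; ring.
rewrite {}/S.
apply: (big_ind (fun s => exists2 z, B z & s = f pi * (y * z))).
- by exists 0; rewrite ?mulr0 //; exact: sa0.
- by move=> _ _ [u Bu ->] [v Bv ->]; exists (u + v); [exact: sa_add | ring].
move=> i _; have [|d def_d] := residue_bin dvrO (i := i.+1).
  by case: i => i /=; rewrite -{2}(prednK q_gt0).
rewrite add1n (prednK q_gt0) -[_ *+ 'C(_, _)]mulr_natl -(rmorph_nat f) def_d.
rewrite exprS rmorphM.
exists (f d * (x ^+ (q - i.+1) * y ^+ i)).
  by apply/sa_scale/sa_mul; apply: sa_exp.
by ring.
Qed.

(** With d = a - b, the error terms are d^q, of exponent at least 2(n+1), and a multiple of pi d, of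
    exponent n+2. The hypothesis starts at exponent 1 because d^q gains nothing at exponent 0. *)
Lemma adic_expr_card n a b : B b -> adic n.+1 (a - b) ->
  adic n.+2 (a ^+ q - b ^+ q).
Proof.
move=> Bb ad; have Bd := adic_sub ad.
have [z Bz] := exprD_card Bb Bd; rewrite [b + _]addrC subrK => ->.
have -> : forall u v w : R, u + v + w - u = v + w by move=> u v w; ring.
apply: adicD; last by apply/adicS/adicMr.
apply: adicW (adicX q ad).
rewrite (leq_trans _ (leq_mul (leqnn _) (finNzRing_gt1 k))) //.
by rewrite muln2 -addnn addSn addnS !ltnS leq_addr.
Qed.

Lemma adic_expr_card_iter n t a b : B b -> adic n.+1 (a - b) ->
  adic (t + n).+1 (a ^+ (q ^ t) - b ^+ (q ^ t)).
Proof.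
move=> Bb ab; elim: t => [|t IHt]; first by rewrite !expr1.
by rewrite !expnSr !exprM addSn; apply: adic_expr_card IHt; exact: sa_exp.
Qed.

Section Finite.
Hypothesis finB : finite_module f B.

(** The differences are expanded on a finite generating family, possibly with relations, and the
    resulting series of coefficients are summed in [O]. *)
Lemma finite_adic_lim (z : nat -> R) :
    (forall n, B (z n)) -> (forall n, adic n (z n.+1 - z n)) ->
  exists2 l, B l & forall n, adic n (l - z n).
Proof.
move=> Bz dz; have [m [e [Be e_gen]]] := finB.
have /choice[c def_c] : forall n, exists c : 'I_m -> O,
    z n.+1 - z n = f pi ^+ n * \sum_i f (c i) * e i.
  by move=> n; have [b /e_gen[c ->] ->] := dz n; exists c.
have /choice[l l_lim] : forall i, exists l, forall n, exists d,
    l - \sum_(j < n) pi ^+ j * c j i = pi ^+ n * d.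
  move=> i; apply: (adic_lim dvrO) => n; exists (c n i).
  by rewrite big_ord_recr /= addrAC subrr add0r.
have zE n : z n = z 0 + \sum_i f (\sum_(j < n) pi ^+ j * c j i) * e i.
  elim: n => [|n IHn].
    by rewrite big1 ?addr0 // => i _; rewrite big_ord0 rmorph0 mul0r.
  rewrite -[z n.+1](subrK (z n)) def_c IHn addrCA; congr (_ + _).
  rewrite mulr_sumr -big_split /=; apply: eq_bigr => i _.
  by rewrite big_ord_recr /= rmorphD rmorphM rmorphXn; ring.
exists (z 0 + \sum_i f (l i) * e i).
  by apply: sa_add => //; apply: sa_sum => i _; exact: sa_scale.
move=> n; rewrite (zE n) opprD addrACA subrr add0r -sumrB.
rewrite (eq_bigr (fun i => f (l i - \sum_(j < n) pi ^+ j * c j i) * e i)).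
  exact: adic_lincomb.
by move=> i _; rewrite rmorphB mulrBl.
Qed.

(** The residues of the coefficients of an element determine it modulo [pi], and they take finitely
    many values. *)
Lemma adic_pigeonhole (z : nat -> R) : (forall n, B (z n)) ->
  exists i j, (i < j)%N /\ adic 1 (z j - z i).
Proof.
move=> Bz; have [m [e [Be e_gen]]] := finB.
have /choice[c def_c] : forall n, exists c : 'I_m -> O,
    z n = \sum_i f (c i) * e i by move=> n; apply: e_gen.
pose code n : {ffun 'I_m -> k} := [ffun i => rho (c n i)].
pose N := #|{ffun 'I_m -> k}|.
have /injectivePn[i [j neq_ij code_ij]] :
    ~~ injectiveb (fun i : 'I_N.+1 => code i).
  apply/negP => /injectiveP/leq_card; rewrite card_ord.
  by rewrite ltnn.
have adic_ij i' j' : code i' = code j' -> adic 1 (z j' - z i').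
  move/ffunP => code_ij'; rewrite !def_c -sumrB.
  rewrite (eq_bigr (fun t => f (c j' t - c i' t) * e t)).
    apply: adic_lincomb => // t; apply/(residue_ker dvrO).
    by have := code_ij' t; rewrite !ffunE rmorphB => ->; rewrite subrr.
  by move=> t _; rewrite rmorphB mulrBl.
have /orP[lt_ij|lt_ji] : (i < j)%N || (j < i)%N by rewrite -neq_ltn.
  by exists i, j; split=> //; apply: adic_ij.
by exists j, i; split=> //; apply: adic_ij.
Qed.

Hypothesis tfB : torsion_free f B.

Lemma uniformizer_expr_neq0 n : pi ^+ n != 0.
Proof. by rewrite expf_neq0 ?(uniformizer_neq0 dvrO). Qed.

Lemma dvd_min (s : seq O) : s != [::] ->
  exists2 x, x \in s & forall y, y \in s -> exists d, y = x * d.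
Proof.
elim: s => // x [|y s] IHs _.
  exists x => [|y]; rewrite inE // => /eqP->.
  by exists 1; rewrite mulr1.
have [//|z sz z_min] := IHs.
have [[d def_x]|[d def_z]] := uniformizer_dvd_total dvrO x z.
  exists z; first by rewrite inE sz orbT.
  by move=> t; rewrite inE => /predU1P[->|/z_min//]; exists d.
exists x; first by rewrite inE eqxx.
move=> t; rewrite inE => /predU1P[->|/z_min[u ->]].
  by exists 1; rewrite mulr1.
by exists (pi * d * u); rewrite mulrA -def_z.
Qed.

(** A generating family of least size is free. A nontrivial relation can be divided by a coefficient
    dividing all the others, thanks to torsion-freeness; one generator is then a combination of the
    rest. *)
Lemma finite_basis : exists n (e : 'I_n -> R), [/\ forall i, B (e i),
    forall x, B x -> exists c : 'I_n -> O, x = \sum_i f (c i) * e i &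
    forall c : 'I_n -> O, \sum_i f (c i) * e i = 0 -> forall i, c i = 0].
Proof.
pose gens n := exists e : 'I_n -> R, (forall i, B (e i)) /\
  forall x, B x -> exists c : 'I_n -> O, x = \sum_i f (c i) * e i.
have [m0 gens_m0] : exists m, gens m by [].
have ex_m : exists m, `[< gens m >] by exists m0; apply/asboolP.
case: (ex_minnP ex_m) => m /asboolP[e [Be e_gen]] m_min.
exists m, e; split=> // c c_rel; apply: contrapT => /existsNP[i0 /eqP c_i0].
case: m => [|m] in e Be e_gen m_min c c_rel i0 c_i0 *; first by case: i0 c_i0.
have [|_ /codomP[i1 ->] c_min] := @dvd_min (codom c).
  by apply/eqP => c_nil; have := codom_f c i0; rewrite c_nil.
have /choice[d def_d] : forall i, exists d, c i = c i1 * d.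
  by move=> i; apply: c_min; exact: codom_f.
have c_i1 : c i1 != 0 by apply: contraNneq c_i0 => c0; rewrite def_d c0 mul0r.
have d_i1 : d i1 = 1 by apply: (mulfI c_i1); rewrite -def_d mulr1.
have d_rel : \sum_i f (d i) * e i = 0.
  apply: (tfB _ c_i1); first by apply: sa_sum => i _; apply: sa_scale.
  rewrite mulr_sumr -[RHS]c_rel; apply: eq_bigr => i _.
  by rewrite (def_d i) rmorphM mulrA.
suff : (m.+1 <= m)%N by rewrite ltnn.
apply: m_min; apply/asboolP; exists (fun i => e (lift i1 i)); split=> // x.
case/e_gen=> b ->; exists (fun i => b (lift i1 i) - b i1 * d (lift i1 i)).
have -> : \sum_i f (b i) * e i = \sum_i f (b i - b i1 * d i) * e i.
  apply: subr0_eq; rewrite -sumrB -[RHS](mulr0 (f (b i1))) -[X in _ * X]d_rel.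
  rewrite mulr_sumr.
  by apply: eq_bigr => i _; rewrite rmorphB rmorphM; ring.
by rewrite (bigD1_ord i1) //= d_i1 mulr1 subrr rmorph0 mul0r add0r.
Qed.

Lemma finite_adic_separated x : (forall n, adic n x) -> x = 0.
Proof.
move=> x_div; have [m [e [Be e_gen e_free]]] := finite_basis.
have [c def_x] := e_gen x (adic_sub (x_div 0)).
rewrite def_x big1 // => i _; rewrite [c i](adic_separated dvrO) ?rmorph0 ?mul0r //.
move=> n; have [b /e_gen[d ->]] := x_div n; rewrite def_x => /eqP.
rewrite mulr_sumr -subr_eq0 -sumrB => /eqP E; exists (d i); apply: subr0_eq.
move: i; apply: e_free; rewrite -[RHS]E; apply: eq_bigr => i _.
by rewrite rmorphB rmorphM rmorphXn mulrBl mulrA.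
Qed.

(** The powers x^(q^n) repeat modulo [pi]: y = x^(q^i) is congruent to y^(q^(t+1)). As q-th powers
    sharpen congruences, the sequence y^(q^((t+1)n)) converges, and its limit is fixed by the
    q^(t+1)-th power. *)
Lemma finite_teichmuller x : B x -> exists i t w,
  [/\ B w, w ^+ (q ^ t.+1) = w & adic 1 (x ^+ (q ^ i) - w)].
Proof.
move=> Bx; have [|i [j [lt_ij x_ij]]] := adic_pigeonhole (z := fun n => x ^+ (q ^ n)).
  by move=> n; exact: sa_exp.
pose t := (j - i).-1; pose y := x ^+ (q ^ i).
have By : B y by exact: sa_exp.
have jE : j = (i + t.+1)%N by rewrite /t prednK ?subn_gt0 // subnKC // ltnW.
have y_t : adic 1 (y ^+ (q ^ t.+1) - y) by rewrite /y -exprM -expnD -jE.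
have q_t n : (n < t.+1 * n.+1)%N by rewrite mulSn ltn_addr.
have [||w Bw w_lim] := @finite_adic_lim (fun n => y ^+ (q ^ (t.+1 * n))).
- by move=> n; exact: sa_exp.
- move=> n; rewrite mulnS expnD exprM.
  apply: (@adicW _ (t.+1 * n + 0).+1); first by rewrite addn0 ltnW // ltnS leq_pmull.
  by apply: adic_expr_card_iter.
exists i, t, w; split=> //.
  apply: subr0_eq; apply: finite_adic_separated => n; apply: (adicW (leqnSn n)).
  apply: (@adic_trans _ (y ^+ (q ^ (t.+1 * n.+1)) ^+ (q ^ t.+1))).
    have := adic_expr_card_iter t.+1 (sa_exp _ By) (w_lim n.+1).
    by apply: adicW; rewrite ltnS leq_addl.
  rewrite -exprM -expnD -mulnSr; apply: adicC.
  by apply: adicW (w_lim n.+2).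
apply: (@adic_trans _ (y ^+ (q ^ (t.+1 * 1)))); last exact: adicC.
by rewrite muln1; exact: adicC.
Qed.

Lemma finite_unit b : B b -> exists2 c, B c & (1 + f pi * b) * c = 1.
Proof.
move=> Bb; pose z n := \sum_(i < n) (- (f pi * b)) ^+ i.
have Bpb : B (- (f pi * b)) by apply/sa_opp/sa_scale.
have adic_pb n : adic n ((- (f pi * b)) ^+ n).
  rewrite -[n in adic n]mul1n; apply: adicX; apply: adicN.
  by rewrite -{1}[f pi]expr1; exact: adic_uniformizer.
have [n|n|c Bc c_lim] := @finite_adic_lim z.
- by apply: sa_sum => i _; exact: sa_exp.
- by rewrite /z big_ord_recr /= addrAC subrr add0r.
exists c => //; apply: subr0_eq; apply: finite_adic_separated => n.
have E : (1 + f pi * b) * z n = 1 - (- (f pi * b)) ^+ n.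
  have := subrXX 1 (- (f pi * b)) n; rewrite expr1n opprK => ->.
  by congr (_ * _); apply: eq_bigr => i _; rewrite expr1n mul1r.
have -> : (1 + f pi * b) * c - 1 =
    (1 + f pi * b) * (c - z n) - (- (f pi * b)) ^+ n.
  by rewrite mulrBr E; ring.
apply: adicB => //; apply: adicMl => //.
by apply: sa_add; [exact: sa1 | exact: sa_scale].
Qed.

(** Along a basis e_j, a sum of b(x_i, y_i) becomes the sum over j of b(u_j, e_j), where u_j is the
    sum of the x_i weighted by the j-th coordinates of the y_i. Testing the hypothesis on the
    bilinear maps [fun z m => coord m j *: z] gives g(u_j) = 0, so u_j = 0. *)
Lemma finite_flat : flat_module f B.
Proof.
have [m [e [Be e_gen e_free]]] := finite_basis.
have coord_uniq (c d : 'I_m -> O) :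
    \sum_i f (c i) * e i = \sum_i f (d i) * e i -> c =1 d.
  move/eqP; rewrite -subr_eq0 -sumrB => /eqP E i; apply: subr0_eq.
  move: i; apply: e_free; rewrite -[RHS]E; apply: eq_bigr => i _.
  by rewrite rmorphB mulrBl.
(* [coord] is total with default 0 off [B]; it is linear on [B], which is where [bilinear_on]
   looks. *)
have /choice[coord coordE] : forall x, exists c : 'I_m -> O,
    B x -> x = \sum_i f (c i) * e i.
  move=> x; have [/e_gen[c ->]|nBx] := pselect (B x); first by exists c.
  by exists (fun=> 0).
have coord_lin c x y : B x -> B y ->
    coord (f c * x + y) =1 fun i => c * coord x i + coord y i.
  move=> Bx By; apply: coord_uniq.
  rewrite -coordE; last by apply: sa_add => //; apply: sa_scale.
  rewrite {1}(coordE x Bx) {1}(coordE y By) mulr_sumr -big_split /=.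
  by apply: eq_bigr => i _; rewrite rmorphD rmorphM mulrDl mulrA.
move=> N' N g g_inj n x y By gx0 P b [b_linl b_linr].
have b0r z : b z 0 = 0.
  have := b_linr z 1 0 0 sa0 sa0; rewrite mulr0 addr0 scale1r => /eqP.
  by rewrite eq_sym -subr_eq0 addrK => /eqP.
have b0l z : B z -> b 0 z = 0.
  move=> Bz; have := b_linl z Bz 1 0 0; rewrite scaler0 addr0 scale1r => /eqP.
  by rewrite eq_sym -subr_eq0 addrK => /eqP.
have b_sumr z (c : 'I_m -> O) :
    b z (\sum_i f (c i) * e i) = \sum_i c i *: b z (e i).
  elim: (index_enum _) => [|i r IHr]; first by rewrite !big_nil.
  by rewrite !big_cons b_linr ?IHr //; apply: sa_sum => i' _; apply: sa_scale.
have b_suml z (c : 'I_n -> O) : B z ->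
    b (\sum_i c i *: x i) z = \sum_i c i *: b (x i) z.
  move=> Bz; elim: (index_enum _) => [|i r IHr]; first by rewrite !big_nil b0l.
  by rewrite !big_cons b_linl ?IHr.
rewrite (eq_bigr (fun i => \sum_j coord (y i) j *: b (x i) (e j))); last first.
  by move=> i _; rewrite -b_sumr -coordE.
rewrite exchange_big big1 //= => j _; rewrite -b_suml //.
suff -> : \sum_i coord (y i) j *: x i = 0 by exact: b0l.
apply: g_inj; rewrite linear0 linear_sum /=.
apply: etrans (gx0 N (fun z m => coord m j *: z) _).
  by apply: eq_bigr => i _; rewrite linearZ.
split=> [z Bz c u v|z c u v Bu Bv]; first by rewrite scalerDr !scalerA mulrC.
by rewrite coord_lin // scalerDl scalerA.
Qed.
End Finite.
End Subalgebra.

Lemma sum_enum_val (V : nmodType) (I : finType) (F : I -> V) :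
  \sum_i F i = \sum_(i < #|I|) F (enum_val i).
Proof. by apply: reindex; exact: onW_bij (enum_val_bij I). Qed.

Lemma finite_module_fintype (O : idomainType) (R : comPzRingType)
    (f : {rmorphism O -> R}) (A : set R) (I : finType) (e : I -> R) :
    (forall i, A (e i)) ->
    (forall x, A x -> exists c : I -> O, x = \sum_i f (c i) * e i) ->
  finite_module f A.
Proof.
move=> Ae e_gen; exists #|I|, (fun i => e (enum_val i)); split=> // x /e_gen[c ->].
by exists (fun i => c (enum_val i)); exact: sum_enum_val.
Qed.

(** * Integral elements, and the locality of the integral closure *)

Section Integral.
Variables (O : idomainType) (L : fieldType) (g : {rmorphism O -> L}).
Local Notation int := (integralOver g).
Local Notation "h ^g" := (map_poly g h) (at level 2, format "h ^g").

Lemma integral_subalgebra : subalgebra g [set x | int x].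
Proof.
split=> [|x y|x y|c x] /=.
- exact: integral1.
- exact: integral_sub.
- exact: integral_mul.
- by apply: integral_mul; apply: integral_id.
Qed.

(** The row of generators is an eigenvector, with eigenvalue [x], of the matrix of multiplication by
    [x]; it is nonzero because 1 is in [B]. So [x] is a root of a characteristic polynomial over
    [O]. *)
Lemma finite_integral (B : set L) x :
  subalgebra g B -> finite_module g B -> B x -> int x.
Proof.
move=> saB [n [e [Be e_gen]]] Bx.
have /choice[c def_c] : forall i, exists c : 'I_n -> O,
    x * e i = \sum_j g (c j) * e j by move=> i; apply/e_gen/(sa_mul saB).
pose M : 'M[O]_n := \matrix_(j, i) c i j.
exists (char_poly M); first exact: char_poly_monic.
rewrite map_char_poly -eigenvalue_root_char; apply/eigenvalueP.
exists (\row_i e i); first by apply/rowP => i; rewrite !mxE def_c;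
  apply: eq_bigr => j _; rewrite !mxE mulrC.
apply/eqP => e0; have [b] := e_gen 1 (sa1 saB); apply/eqP.
rewrite big1 ?oner_eq0 // => i _.
by have /rowP/(_ i) := e0; rewrite !mxE => ->; rewrite mulr0.
Qed.

(** [B'] is B[x]. The span [V] of the powers of [x] below the degree of the monic equation is stable
    under multiplication by [x], hence contains B[x]. *)
Lemma finite_adjoin (B : set L) x :
    subalgebra g B -> finite_module g B -> int x ->
  exists B', [/\ subalgebra g B', finite_module g B', B `<=` B' & B' x].
Proof.
move=> saB [m [e [Be e_gen]]] [h h_mon hx0].
have [B0 B1] : B 0 /\ B 1 by split; [exact: sa0 saB | exact: sa1 saB].
pose B' := [set y | exists2 P : {poly L}, (forall i, B P`_i) & y = P.[x]].
pose d := (size h).-1.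
pose V := [set y | exists2 b : 'I_d -> L, (forall i, B (b i)) &
  y = \sum_i b i * x ^+ i].
have V0 : V 0.
  by exists (fun=> 0) => //; rewrite big1 // => i _; rewrite mul0r.
have VD u v : V u -> V v -> V (u + v).
  move=> [b Bb ->] [c Bc ->]; exists (fun i => b i + c i).
    by move=> i; apply: (sa_add saB).
  by rewrite -big_split /=; apply: eq_bigr => i _; rewrite mulrDl.
have VZ b u : B b -> V u -> V (b * u).
  move=> Bb [c Bc ->]; exists (fun i => b * c i).
    by move=> i; apply: (sa_mul saB).
  by rewrite mulr_sumr; apply: eq_bigr => i _; rewrite mulrA.
have Vx i : (i < d)%N -> V (x ^+ i).
  move=> lt_id; exists (fun j => (i == j :> nat)%:R).
    by move=> j; case: eqP.
  rewrite (bigD1 (Ordinal lt_id)) //= eqxx mul1r big1 ?addr0 // => j.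
  by rewrite -val_eqE eq_sym => /negPf/= ->; rewrite mul0r.
have Vxd : V (x ^+ d).
  have -> : x ^+ d = \sum_(i < d) g (- h`_i) * x ^+ i.
    move/rootP: hx0; rewrite horner_coef size_map_poly_id0; last first.
      by rewrite (monicP h_mon) rmorph1 oner_neq0.
    rewrite -(@prednK (size h)); last by rewrite lt0n size_poly_eq0 monic_neq0.
    rewrite big_ord_recr /= -/d coef_map /= -lead_coefE (monicP h_mon).
    rewrite rmorph1 mul1r addrC => /eqP; rewrite addr_eq0 => /eqP->.
    by rewrite -sumrN; apply: eq_bigr => i _; rewrite coef_map rmorphN mulNr.
  by exists (fun i : 'I_d => g (- h`_i)) => // i; exact: (sa_const saB).
have Vmulx u : V u -> V (u * x).
  move=> [b Bb ->]; rewrite mulr_suml; apply: (big_ind V) => // i _.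
  rewrite -mulrA -exprSr; apply: VZ => //.
  have := ltn_ord i; rewrite leq_eqVlt => /predU1P[->//|]; exact: Vx.
have Vexp n : V (x ^+ n).
  elim: n => [|n IHn]; last by rewrite exprSr; apply: Vmulx.
  (* When [d] is 0, x^0 is x^d, covered by [Vxd]. *)
  by have [d0|d_gt0] := posnP d; [rewrite -d0 | apply: Vx].
have B'V y : B' y -> V y.
  move=> [P BP ->]; rewrite horner_coef; apply: (big_ind V) => // i _.
  exact: VZ.
exists B'; split.
- split.
  + exists 1; last by rewrite hornerE.
    by move=> i; rewrite coef1; case: eqP.
  + move=> _ _ [P BP ->] [Q BQ ->]; exists (P - Q); last by rewrite !hornerE.
    by move=> i; rewrite coefB; apply: (sa_sub saB).
  + move=> _ _ [P BP ->] [Q BQ ->]; exists (P * Q); last by rewrite !hornerE.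
    move=> i; rewrite coefM; apply: (sa_sum saB) => j _.
    exact: (sa_mul saB).
  + move=> c _ [P BP ->]; exists (g c *: P); last by rewrite !hornerE.
    by move=> i; rewrite coefZ; apply: (sa_scale saB).
- apply: (@finite_module_fintype _ _ _ _ ('I_d * 'I_m)%type
    (fun ij => x ^+ ij.1 * e ij.2)).
    move=> ij; exists ('X^(ij.1) * (e ij.2)%:P); last by rewrite !hornerE.
    move=> i; rewrite coefMC coefXn; case: eqP => _; rewrite ?mul1r ?mul0r //.
  move=> y /B'V[b Bb ->].
  have /choice[c def_c] : forall i, exists c : 'I_m -> O,
      b i = \sum_j g (c j) * e j by move=> i; apply: e_gen.
  exists (fun ij => c ij.1 ij.2).
  rewrite -(pair_bigA _ (fun i j => g (c i j) * (x ^+ i * e j))) /=.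
  apply: eq_bigr => i _; rewrite def_c mulr_suml; apply: eq_bigr => j _.
  by rewrite -mulrA [x ^+ i * _]mulrC.
- move=> b Bb; exists b%:P; last by rewrite hornerE.
  by move=> i; rewrite coefC; case: eqP.
- exists 'X; last by rewrite hornerE.
  by move=> i; rewrite coefX; case: eqP.
Qed.

Lemma finite_base : exists B : set L, subalgebra g B /\ finite_module g B.
Proof.
exists (range g); split.
  split; first by exists 1; rewrite ?rmorph1.
  - by move=> _ _ [c _ <-] [d _ <-]; exists (c - d); rewrite ?rmorphB.
  - by move=> _ _ [c _ <-] [d _ <-]; exists (c * d); rewrite ?rmorphM.
  - by move=> c _ [d _ <-]; exists (c * d); rewrite ?rmorphM.
apply: (@finite_module_fintype _ _ _ _ unit (fun=> 1)).
  by move=> _; exists 1; rewrite ?rmorph1.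
by move=> _ [c _ <-]; exists (fun=> c); rewrite big_const card_unit /= addr0 mulr1.
Qed.

Lemma finite_adjoin_seq (s : seq L) : (forall x, x \in s -> int x) ->
  exists B, [/\ subalgebra g B, finite_module g B & forall x, x \in s -> B x].
Proof.
elim: s => [_|x s IHs s_int].
  by have [B [saB finB]] := finite_base; exists B; split.
have [|B [saB finB Bs]] := IHs.
  by move=> y sy; apply: s_int; rewrite inE sy orbT.
have [|B' [saB' finB' BB' B'x]] := finite_adjoin saB finB (x := x).
  by apply: s_int; rewrite inE eqxx.
exists B'; split=> // y; rewrite inE => /predU1P[->//|/Bs]; exact: BB'.
Qed.

(** [sep_max] is the case of [g] equal to [j \o iota]. That this set is closed under addition is the
    content of [int_maxD]. *)
Definition int_max x := int x /\ forall y, int y -> x * y != 1.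

Lemma int_max_expr x n : int x -> int_max (x ^+ n) -> int_max x.
Proof.
move=> x_int [_ xn_max]; split=> // y y_int; apply/negP => /eqP xy.
have /xn_max/eqP := sa_exp integral_subalgebra n y_int.
by rewrite -exprMn xy expr1n.
Qed.

Lemma int_max_mul c x : int c -> int_max x -> int_max (c * x).
Proof.
move=> c_int [x_int x_max]; split=> [|y y_int]; first exact: integral_mul.
by rewrite -mulrA mulrCA; apply: x_max; apply: integral_mul.
Qed.

Lemma int_max_neq1 : ~ int_max 1.
Proof. by move=> [i1 /(_ 1 i1)]; rewrite mulr1 eqxx. Qed.

Lemma int_nmax x : int x -> ~ int_max x -> exists2 y, int y & x * y = 1.
Proof.
move=> x_int x_nmax; apply: contrapT => x_nunit; apply: x_nmax.
by split=> // y y_int; apply/eqP => xy; apply: x_nunit; exists y.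
Qed.

Lemma int_max_prime x y : int x -> int y -> int_max (x * y) ->
  int_max x \/ int_max y.
Proof.
move=> x_int y_int xy_max.
have [x_max|/(int_nmax x_int)[z z_int xz]] := pselect (int_max x); first by left.
right; have -> : y = z * (x * y) by rewrite mulrA [z * x]mulrC xz mul1r.
exact: int_max_mul.
Qed.

Hypothesis g_inj : injective g.
Variables (k : finFieldType) (rho : {rmorphism O -> k}) (pi : O).
Hypothesis dvrO : complete_dvr rho pi.
Local Notation q := #|k|.

Lemma field_torsion_free (B : set L) : torsion_free g B.
Proof.
move=> c x _ c0 /eqP; rewrite mulf_eq0 => /orP[|/eqP//].
by rewrite -(rmorph0 g) (inj_eq g_inj) (negPf c0).
Qed.

Lemma one_add_uniformizer_unit b : int b ->
  exists2 c, int c & (1 + g pi * b) * c = 1.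
Proof.
move=> b_int; have [|B [saB finB Bs]] := @finite_adjoin_seq [:: b].
  by move=> x; rewrite inE => /eqP->.
have Bb : B b by apply: Bs; rewrite inE.
have [c Bc Ec] := finite_unit saB dvrO finB (field_torsion_free (B := B)) Bb.
by exists c => //; apply: finite_integral Bc.
Qed.

(** If y inverted pi b, then 1 = pi^n (b y)^n for all n, against separatedness of a finite
    subalgebra containing b y. *)
Lemma int_max_uniformizer b : int b -> int_max (g pi * b).
Proof.
move=> b_int; split=> [|y y_int]; first by apply/integral_mul/b_int/integral_id.
apply/negP => /eqP pi_by.
have by_int : int (b * y) by apply: integral_mul.
have [|B [saB finB Bs]] := @finite_adjoin_seq [:: b * y].
  by move=> x; rewrite inE => /eqP->.
have Bby : B (b * y) by apply: Bs; rewrite inE.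
suff /eqP : 1 = 0 :> L by rewrite oner_eq0.
apply: (finite_adic_separated saB dvrO finB (field_torsion_free (B := B))) => n.
exists ((b * y) ^+ n); first exact: (sa_exp saB).
by rewrite -exprMn mulrA pi_by expr1n.
Qed.

Lemma int_teichmuller x : int x -> exists i t w b,
  [/\ int w, int b, w ^+ (q ^ t.+1) = w & x ^+ (q ^ i) = w + g pi * b].
Proof.
move=> x_int; have [|B [saB finB Bs]] := @finite_adjoin_seq [:: x].
  by move=> y; rewrite inE => /eqP->.
have Bx : B x by apply: Bs; rewrite inE.
have [i [t [w [Bw wQ]]]] :=
  finite_teichmuller saB dvrO finB (field_torsion_free (B := B)) Bx.
case=> b Bb xw; exists i, t, w, b; split=> //.
- exact: finite_integral Bw.
- exact: finite_integral Bb.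
- by rewrite expr1 in xw; rewrite -xw addrC subrK.
Qed.

Lemma expn_card_gt0 i : (0 < q ^ i)%N.
Proof. by rewrite expn_gt0 (ltnW (finNzRing_gt1 k)). Qed.

(** The Teichmueller element [w] close to a power of [x] is either 0 or a root of unity of order
    dividing q^(t+1) - 1. *)
Lemma int_expr_uniformizer x : int x -> exists n b, int b /\
  (x ^+ n = g pi * b \/ (0 < n)%N /\ x ^+ n = 1 + g pi * b).
Proof.
move=> x_int; have [i [t [w [b [w_int b_int wQ xw]]]]] := int_teichmuller x_int.
have [w0|w_neq0] := eqVneq w 0.
  by exists (q ^ i)%N, b; split=> //; left; rewrite xw w0 add0r.
have Q_gt1 : (1 < q ^ t.+1)%N.
  by rewrite -{1}(exp1n t.+1) ltn_exp2r // finNzRing_gt1.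
pose m := (q ^ t.+1).-1; have wm : w ^+ m = 1.
  apply: (mulfI w_neq0); rewrite mulr1 -exprS prednK //; exact: ltnW.
have m_gt0 : (0 < m)%N by rewrite /m -subn1 subn_gt0.
have := subrXX (w + g pi * b) w m; rewrite -xw wm => E.
exists (q ^ i * m)%N, (b * \sum_(j < m) (x ^+ (q ^ i)) ^+ (m.-1 - j) * w ^+ j).
have saI := integral_subalgebra.
split.
  apply: integral_mul => //; apply: (sa_sum saI) => j _.
  by apply: (sa_mul saI); do ?apply: (sa_exp saI).
right; rewrite muln_gt0 expn_card_gt0 m_gt0; split=> //.
rewrite exprM -[LHS](subrK 1) E addrC; congr (_ + _).
by rewrite xw addrAC subrr add0r mulrA.
Qed.

(** The non-units are the radical of the ideal of [pi]: elements 1 + pi b are units by completeness,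
    so no positive power of a non-unit has that form. *)
Lemma int_maxE x : int_max x <-> int x /\ exists n b, int b /\ x ^+ n = g pi * b.
Proof.
split=> [x_max|[x_int [n [b [b_int xn]]]]]; last first.
  by apply: (int_max_expr (n := n)) => //; rewrite xn; apply: int_max_uniformizer.
have [x_int x_nunit] := x_max; split=> //.
have [n [b [b_int [xn|[n_gt0 xn]]]]] := int_expr_uniformizer x_int.
  by exists n, b.
have [c c_int] := one_add_uniformizer_unit b_int.
rewrite -xn -(prednK n_gt0) exprS -mulrA => /eqP E.
suff /x_nunit/negP : int (x ^+ n.-1 * c) by [].
by apply: integral_mul => //; apply: (sa_exp integral_subalgebra).
Qed.

(** Each term of (x + y)^(m+n) contains x^m or y^n, hence [pi]. *)
Lemma int_maxD x y : int_max x -> int_max y -> int_max (x + y).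
Proof.
have saI := integral_subalgebra.
move=> /int_maxE[x_int [m [b [b_int xm]]]] /int_maxE[y_int [n [c [c_int yn]]]].
apply/int_maxE; split; first exact: integral_add.
exists (m + n)%N; rewrite exprDn.
apply: (big_ind (fun s => exists b, int b /\ s = g pi * b)).
- by exists 0; rewrite mulr0; split=> //; apply: integral0.
- move=> _ _ [u [u_int ->]] [v [v_int ->]]; exists (u + v).
  by rewrite mulrDr; split=> //; apply: integral_add.
move=> i _; have [le_mi|lt_im] := leqP i n.
  exists (b * x ^+ (n - i) * y ^+ i *+ 'C(m + n, i)).
  split; last by rewrite -addnBA // exprD xm mulrnAr !mulrA.
  rewrite -mulr_natr; apply: (sa_mul saI); last exact: integral_nat.
  by do !apply: (sa_mul saI) => //; apply: (sa_exp saI).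
exists (x ^+ (m + n - i) * (c * y ^+ (i - n)) *+ 'C(m + n, i)).
split; last by rewrite -{2}(subnKC (ltnW lt_im)) exprD yn mulrnAr; congr (_ *+ _); ring.
rewrite -mulr_natr; apply: (sa_mul saI); last exact: integral_nat.
by do !apply: (sa_mul saI) => //; apply: (sa_exp saI).
Qed.

Lemma int_maxN x : int_max x -> int_max (- x).
Proof.
rewrite -mulN1r; apply: int_max_mul.
by apply: integral_opp; apply: integral1.
Qed.

Lemma int_maxB x y : int_max x -> int_max y -> int_max (x - y).
Proof. by move=> ? /int_maxN; apply: int_maxD. Qed.

Lemma int_max_sum (I : Type) (r : seq I) (P : pred I) (F : I -> L) :
  (forall i, P i -> int_max (F i)) -> int_max (\sum_(i <- r | P i) F i).
Proof.
move=> F_max; apply: (big_ind int_max) => //; last exact: int_maxD.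
rewrite -(mulr0 (g pi)); apply: int_max_uniformizer; exact: integral0.
Qed.

Lemma one_sub_max_unit x : int_max x -> exists2 c, int c & (1 - x) * c = 1.
Proof.
move=> x_max; apply: int_nmax.
  by apply: integral_sub; [exact: integral1 | case: x_max].
by move=> /int_maxD/(_ x_max); rewrite subrK; apply: int_max_neq1.
Qed.

Lemma int_max_card t : int_max (q ^ t.+1)%:R.
Proof.
have [|d qE] := residue_bin dvrO (i := 1); first by rewrite finNzRing_gt1.
rewrite expnS natrM mulrC; apply: int_max_mul; first exact: integral_nat.
rewrite bin1 in qE; rewrite -(rmorph_nat g) qE rmorphM.
by apply: int_max_uniformizer; apply: integral_id.
Qed.

(** The cofactor of a - b in a^n - b^n is congruent to n a^(n-1) modulo a - b. For n a power of q
    this makes the n-th power contracting on a residue class; both the rigidity of Teichmueller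
    elements and the congruence of points use it. *)
Lemma int_max_subXX n a b : int_max n%:R -> int a -> int b -> int_max (a - b) ->
  exists2 m, int_max m & a ^+ n - b ^+ n = (a - b) * m.
Proof.
have saI := integral_subalgebra; move=> n_max a_int b_int ab_max.
exists (\sum_(i < n) a ^+ (n.-1 - i) * b ^+ i); last exact: subrXX.
rewrite -[X in int_max X](subrK (n%:R * a ^+ n.-1)); apply: int_maxD; last first.
  by rewrite mulrC; apply: int_max_mul => //; apply: (sa_exp saI).
rewrite mulr_natl -[X in _ *+ X]card_ord -sumr_const -sumrB; apply: int_max_sum => i _.
have -> : a ^+ n.-1 = a ^+ (n.-1 - i) * a ^+ i.
  by rewrite -exprD subnK // -ltnS prednK // (leq_ltn_trans _ (ltn_ord i)).
rewrite -mulrBr; apply: int_max_mul; first exact: (sa_exp saI).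
rewrite -opprB subrXX; apply: int_maxN; rewrite mulrC; apply: int_max_mul => //.
by apply: (sa_sum saI) => j _; apply: (sa_mul saI); apply: (sa_exp saI).
Qed.

Lemma iter_expr_fixed (w : L) n i : w ^+ n = w -> w ^+ (n ^ i) = w.
Proof.
by move=> wn; elim: i => [|i IHi]; rewrite ?expr1 // expnS exprM wn.
Qed.

(** A power map fixing both elements gives w - w' = (w - w') m with m a non-unit; if w and w'
    differed, m would be 1. *)
Lemma teichmuller_inj w w' t t' : int w -> int w' ->
  w ^+ (q ^ t.+1) = w -> w' ^+ (q ^ t'.+1) = w' -> int_max (w - w') -> w = w'.
Proof.
move=> w_int w'_int wQ w'Q ww'_max; apply/eqP; rewrite -subr_eq0.
pose T := (t.+1 * t'.+1)%N.
have wT : w ^+ (q ^ T) = w by rewrite expnM iter_expr_fixed.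
have w'T : w' ^+ (q ^ T) = w' by rewrite /T mulnC expnM iter_expr_fixed.
have TS : T = T.-1.+1 by rewrite prednK.
have [m m_max] : exists2 m, int_max m & w ^+ (q ^ T) - w' ^+ (q ^ T) = (w - w') * m.
  by apply: int_max_subXX => //; rewrite TS; apply: int_max_card.
rewrite wT w'T; apply: contra_eqT => ww'; apply/negP => /eqP E.
apply: int_max_neq1; suff <- : m = 1 by [].
by apply: (mulfI ww'); rewrite mulr1.
Qed.

(** The coefficients satisfy c^q = c modulo [pi]. The quotient by [pi] is kept in [B]: for B = O[z]
    it has to lie in O[z] again. *)
Lemma horner_expr_card (B : set L) (h : {poly O}) z : subalgebra g B -> B z ->
  adic g B pi 1 (h^g.[z ^+ q] - h^g.[z] ^+ q).
Proof.
move=> saB Bz; have Bh (h' : {poly O}) y : B y -> B h'^g.[y].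
  move=> By; rewrite horner_coef; apply: (sa_sum saB) => i _.
  by rewrite coef_map; apply: (sa_scale saB); apply: (sa_exp saB).
elim/poly_ind: h => [|h c IHh].
  by rewrite rmorph0 !horner0 expr0n gtn_eqF ?(ltnW (finNzRing_gt1 k)) //
    subr0; apply: (adic0 saB).
rewrite rmorphD rmorphM /= map_polyX map_polyC /= !hornerE.
have [||y By ->] := exprD_card saB dvrO (x := h^g.[z] * z) (y := g c).
- by apply: (sa_mul saB) => //; apply: Bh.
- exact: (sa_const saB).
have [d cq] := residue_expr_card dvrO c.
rewrite -rmorphXn cq rmorphD rmorphM exprMn.
set u := h^g.[_ ^+ _] in IHh *; set v := _ ^+ q in IHh *.
have -> : u * z ^+ q + g c - (v * z ^+ q + (g c + g pi * g d) + g pi * (g c * y)) =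
    (u - v) * z ^+ q - g pi ^+ 1 * (g d + g c * y) by ring.
apply: (adicB saB).
  by apply: (adicMr saB) => //; apply: (sa_exp saB).
apply: adic_uniformizer; apply: (sa_add saB); first exact: (sa_const saB).
exact: (sa_scale saB).
Qed.

End Integral.

(** * Extending partial homomorphisms to automorphisms of the separable closure *)

Section SeparableClosure.
Variables (K Ksep : fieldType) (j : {rmorphism K -> Ksep}).
Hypothesis jP : is_separable_closure j.

Lemma algebraic_inv_poly (x : Ksep) : x != 0 ->
  exists h : {poly K}, x * (map_poly j h).[x] = 1.
Proof.
move=> x0; have [q q_sep] := jP.1 x.
move: (separable_poly_neq0 q_sep) => {q_sep}.
elim/poly_ind: q => [|h c IHh]; first by rewrite eqxx.
have [->|c0] := eqVneq c 0.
  rewrite addr0 mulf_eq0 polyX_eq0 orbF rmorphM /= map_polyX => h0.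
  by rewrite rootM [root 'X _]rootE hornerX (negPf x0) orbF; apply: IHh.
move=> _; rewrite rootE rmorphD rmorphM /= map_polyX map_polyC !hornerE.
rewrite addr_eq0 => /eqP hx; exists (- c^-1 *: h).
rewrite map_polyZ hornerZ rmorphN fmorphV mulrCA [x * _]mulrC hx.
by rewrite mulrNN mulVf // fmorph_eq0.
Qed.

(* The graph of a K-homomorphism to Ksep defined on a subextension. *)
Definition graph_hom (G : set (Ksep * Ksep)) :=
  [/\ forall a, G (j a, j a),
      forall x y x' y', G (x, y) -> G (x', y') -> G (x - x', y - y'),
      forall x y x' y', G (x, y) -> G (x', y') -> G (x * x', y * y') &
      forall y, G (0, y) -> y = 0].

Section Graph.
Variable G : set (Ksep * Ksep).
Hypothesis homG : graph_hom G.

Lemma graph_const a : G (j a, j a). Proof. by case: homG. Qed.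
Lemma graph0 : G (0, 0).
Proof. by have := graph_const 0; rewrite rmorph0. Qed.
Lemma graph1 : G (1, 1).
Proof. by have := graph_const 1; rewrite rmorph1. Qed.
Lemma graph_sub x y x' y' : G (x, y) -> G (x', y') -> G (x - x', y - y').
Proof. by case: homG => _ H _ _; apply: H. Qed.
Lemma graph_mul x y x' y' : G (x, y) -> G (x', y') -> G (x * x', y * y').
Proof. by case: homG => _ _ H _; apply: H. Qed.
Lemma graph_fun0 y : G (0, y) -> y = 0.
Proof. by case: homG => _ _ _ H; apply: H. Qed.
Lemma graph_add x y x' y' : G (x, y) -> G (x', y') -> G (x + x', y + y').
Proof.
move=> xy xy'; rewrite -[x']opprK -[y']opprK; apply: graph_sub => //.
by rewrite -[- x']sub0r -[- y']sub0r; apply: graph_sub; first exact: graph0.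
Qed.
Lemma graph_sum (I : Type) (r : seq I) (P : pred I) (E F : I -> Ksep) :
    (forall i, P i -> G (E i, F i)) ->
  G (\sum_(i <- r | P i) E i, \sum_(i <- r | P i) F i).
Proof.
apply: (@big_ind2 _ _ (fun x y => G (x, y))); first exact: graph0.
by move=> *; apply: graph_add.
Qed.
Lemma graph_exp x y n : G (x, y) -> G (x ^+ n, y ^+ n).
Proof.
move=> xy; elim: n => [|n IHn]; first exact: graph1.
by rewrite !exprS; apply: graph_mul.
Qed.
Lemma graph_fun x y y' : G (x, y) -> G (x, y') -> y = y'.
Proof.
move=> xy xy'; apply: subr0_eq; apply: graph_fun0.
by rewrite -(subrr x); apply: graph_sub.
Qed.

(** [P] has coefficients in the domain of the partial homomorphism, and [Q] is its image under that
    homomorphism. *)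
Definition graph_poly (P Q : {poly Ksep}) := forall i, G (P`_i, Q`_i).

Lemma graph_poly_map (h : {poly K}) : graph_poly (map_poly j h) (map_poly j h).
Proof. by move=> i; rewrite !coef_map; apply: graph_const. Qed.

Lemma graph_poly_const x y : G (x, y) -> graph_poly x%:P y%:P.
Proof. by move=> xy i; rewrite !coefC; case: eqP => // _; apply: graph0. Qed.

Lemma graph_polyXn n : graph_poly 'X^n 'X^n.
Proof.
by move=> i; rewrite !coefXn; case: eqP => _; [apply: graph1 | apply: graph0].
Qed.

Lemma graph_poly_sub P Q P' Q' :
  graph_poly P Q -> graph_poly P' Q' -> graph_poly (P - P') (Q - Q').
Proof. by move=> PQ PQ' i; rewrite !coefB; apply: graph_sub. Qed.

Lemma graph_poly_mul P Q P' Q' :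
  graph_poly P Q -> graph_poly P' Q' -> graph_poly (P * P') (Q * Q').
Proof.
by move=> PQ PQ' i; rewrite !coefM; apply: graph_sum => l _; apply: graph_mul.
Qed.

Lemma graph_horner P Q x y : graph_poly P Q -> G (x, y) -> G (P.[x], Q.[y]).
Proof.
move=> PQ xy; rewrite !(@horner_coef_wide _ (maxn (size P) (size Q)));
  rewrite ?leq_maxl ?leq_maxr //.
by apply: graph_sum => i _; apply: graph_mul; last exact: graph_exp.
Qed.

(** By algebraicity x^-1 is a polynomial in [x] over [K], and such polynomials are respected by
    [G]. *)
Lemma graph_inv x y : x != 0 -> G (x, y) -> G (x^-1, y^-1).
Proof.
move=> x0 xy; have [h xh] := algebraic_inv_poly x0.
have xyh := graph_horner (graph_poly_map h) xy.
have yh : y * (map_poly j h).[y] = 1.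
  by apply: graph_fun graph1; rewrite -{1}xh; apply: graph_mul.
have invE (z w : Ksep) : z * w = 1 -> z^-1 = w.
  move=> zw; have z0 : z != 0.
    by apply/eqP => z0; move/eqP: zw; rewrite z0 mul0r eq_sym oner_eq0.
  by apply: (mulfI z0); rewrite zw divff.
by rewrite (invE _ _ xh) (invE _ _ yh).
Qed.

Lemma graph_poly0 Q : graph_poly 0 Q -> Q = 0.
Proof.
move=> Q0; apply/polyP => i; rewrite coef0; apply: graph_fun0.
by have := Q0 i; rewrite coef0.
Qed.

Lemma graph_min_poly x : exists H1 H2, [/\ graph_poly H1 H2, H1 \is monic,
    root H1 x & forall P Q, graph_poly P Q -> root P x -> P != 0 ->
    (size H1 <= size P)%N].
Proof.
pose good n := exists H1 H2, [/\ graph_poly H1 H2, H1 \is monic, root H1 x &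
  size H1 = n].
have monicize P Q : graph_poly P Q -> root P x -> P != 0 -> good (size P).
  move=> PQ Px P0; pose c := lead_coef P; pose d := Q`_(size P).-1.
  have c0 : c != 0 by rewrite lead_coef_eq0.
  have cd : G (c^-1, d^-1) by apply: graph_inv => //; exact: PQ.
  exists (c^-1%:P * P), (d^-1%:P * Q); rewrite !mul_polyC; split.
  - by rewrite -!mul_polyC; apply: graph_poly_mul => //; apply: graph_poly_const.
  - by rewrite monicE lead_coefZ mulVf.
  - by rewrite rootZ ?invr_eq0.
  - by rewrite size_scale ?invr_eq0.
have ex_good : exists n, `[< good n >].
  have [q /separable_poly_neq0 q0 qx] := jP.1 x.
  exists (size (map_poly j q)); apply/asboolP.
  by apply: (monicize _ _ (graph_poly_map q)); rewrite // map_poly_eq0.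
case: (ex_minnP ex_good) => n /asboolP[H1 [H2 [H12 H1m H1x <-]]] n_min.
exists H1, H2; split=> // P Q PQ Px P0; apply: n_min; apply/asboolP.
exact: monicize PQ Px P0.
Qed.

(** Euclidean division of [P] by [H1] and of [Q] by [H2] run in parallel, each step using the
    leading coefficient of [P] and its image; minimality forces the remainder of [P] to be 0, and
    then that of [Q]. *)
Lemma graph_min_poly_dvd x H1 H2 : graph_poly H1 H2 -> H1 \is monic ->
    (forall P Q, graph_poly P Q -> root P x -> P != 0 ->
      (size H1 <= size P)%N) -> root H1 x ->
  forall P Q, graph_poly P Q -> root P x -> H1 %| P /\ H2 %| Q.
Proof.
move=> H12 H1m H_min H1x P Q.
have [n le_n] := ubnP (size P); elim: n => // n IHn in P Q le_n *.
move=> PQ Px; have [P0|P0] := eqVneq P 0.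
  by rewrite P0 in PQ *; rewrite (graph_poly0 PQ) !dvdp0.
have le_HP := H_min P Q PQ Px P0.
pose m := (size P - size H1)%N; pose c := lead_coef P; pose d := Q`_(size P).-1.
pose P' := P - c%:P * 'X^m * H1; pose Q' := Q - d%:P * 'X^m * H2.
have lt_P' : (size P' < size P)%N.
  have sP_gt0 : (0 < size P)%N by rewrite size_poly_gt0.
  have sH_gt0 : (0 < size H1)%N by rewrite size_poly_gt0 monic_neq0.
  rewrite -(prednK sP_gt0) ltnS; apply/leq_sizeP => i le_i.
  rewrite coefB -mulrA coefCM coefXnM /m.
  move: le_i; rewrite leq_eqVlt => /predU1P[<-|lt_i].
    have -> : ((size P).-1 < size P - size H1)%N = false by lia.
    have -> : ((size P).-1 - (size P - size H1))%N = (size H1).-1 by lia.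
    by rewrite -!lead_coefE (monicP H1m) mulr1 subrr.
  have le_Pi : (size P <= i)%N by rewrite -(prednK sP_gt0).
  rewrite ltnNge (leq_trans (leq_subr _ _) le_Pi) /= !nth_default ?mulr0 ?subr0 //.
  by rewrite leq_subRL ?subnK // (leq_trans (leq_subr _ _)).
have PQ' : graph_poly P' Q'.
  apply: graph_poly_sub => //; apply: graph_poly_mul => //.
  apply: graph_poly_mul; [apply: graph_poly_const; exact: PQ | exact: graph_polyXn].
have [||H1P' H2Q'] := IHn P' Q' _ PQ'; first exact: leq_trans lt_P' le_n.
  rewrite rootE !hornerE (rootP Px) (rootP H1x) !mulr0 subrr //.
rewrite -[P](subrK (c%:P * 'X^m * H1)) -[Q](subrK (d%:P * 'X^m * H2)).
by split; apply: dvdp_add => //; apply: dvdp_mull.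
Qed.

(** The usual extension step: P(x) is sent to Q(y). It is well defined because P(x) = 0 makes [H2]
    divide [Q]. Both polynomials are separable, as they divide a separable polynomial over [K]. *)
Lemma graph_hom_extend x : exists H1 H2, [/\ graph_poly H1 H2,
    [/\ H1 \is monic, size H2 = size H1, separable_poly H1 & separable_poly H2],
    root H1 x & forall y, root H2 y ->
      exists G', [/\ graph_hom G', G `<=` G' & G' (x, y)]].
Proof.
have [H1 [H2 [H12 H1m H1x H_min]]] := graph_min_poly x.
have H_dvd := graph_min_poly_dvd H12 H1m H_min H1x.
have [q q_sep qx] := jP.1 x.
have [H1q H2q] := H_dvd _ _ (graph_poly_map q) qx.
have qj_sep : separable_poly (map_poly j q) by rewrite separable_map.
exists H1, H2; split=> //.
  split=> //; try exact: dvdp_separable qj_sep.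
  have sH_gt0 : (0 < size H1)%N by rewrite size_poly_gt0 monic_neq0.
  have lead2 : H2`_(size H1).-1 = 1.
    by apply: graph_fun graph1; have := H12 (size H1).-1;
       rewrite -lead_coefE (monicP H1m).
  apply/eqP; rewrite eqn_leq; apply/andP; split.
    apply/leq_sizeP => i le_i; apply: graph_fun0.
    by have := H12 i; rewrite nth_default.
  rewrite leqNgt; apply/negP => lt_H2; move/eqP: lead2.
  by rewrite nth_default ?(eq_sym 0) ?oner_eq0 // -ltnS prednK.
move=> y H2y.
exists [set z | exists P Q, graph_poly P Q /\ z = (P.[x], Q.[y])]; split.
- split.
  + move=> a; exists (j a)%:P, (j a)%:P; rewrite !hornerC; split=> //.
    by apply: graph_poly_const; apply: graph_const.
  + move=> _ _ _ _ [P [Q [PQ [-> ->]]]] [P' [Q' [PQ' [-> ->]]]].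
    exists (P - P'), (Q - Q'); rewrite !hornerE; split=> //.
    exact: graph_poly_sub.
  + move=> _ _ _ _ [P [Q [PQ [-> ->]]]] [P' [Q' [PQ' [-> ->]]]].
    exists (P * P'), (Q * Q'); rewrite !hornerE; split=> //.
    exact: graph_poly_mul.
  + move=> _ [P [Q [PQ [Px ->]]]]; apply/rootP.
    have [|_ H2Q] := H_dvd P Q PQ; first by apply/rootP.
    by rewrite -dvdp_XsubCl; apply: dvdp_trans H2Q; rewrite dvdp_XsubCl.
- move=> [u v] uv; exists u%:P, v%:P; rewrite !hornerC; split=> //.
  exact: graph_poly_const.
- exists 'X, 'X; rewrite !hornerX; split=> //; exact: (graph_polyXn 1).
Qed.

End Graph.

(** The iterates of [sigma] on y stay among the finitely many roots of a polynomial over [K], so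
    they repeat; by injectivity y is itself an iterate of y, hence in the image. *)
Lemma sep_endo_galois (sigma : {rmorphism Ksep -> Ksep}) :
  (forall a, sigma (j a) = j a) -> galois_elt j sigma.
Proof.
move=> sigmaK; split=> //.
suff surj : forall y, exists x, sigma x = y.
  have [s sK] := choice surj.
  by exists s => // x; apply: (fmorph_inj sigma); rewrite sK.
move=> y; have [h h_sep hy] := jP.1 y.
have it_root n : root (map_poly j h) (iter n sigma y).
  elim: n => //= n; rewrite !rootE => /eqP hn.
  rewrite -[map_poly j h](_ : map_poly sigma (map_poly j h) = _).
    by rewrite horner_map /= hn rmorph0.
  by rewrite -map_poly_comp; apply: eq_map_poly => a /=; rewrite sigmaK.
have it_inj n : injective (iter n sigma).
  by elim: n => //= n IHn u v /fmorph_inj/IHn.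
pose N := size (map_poly j h).
have /uniqPn-/(_ 0)[m [n [lt_mn]]] :
    ~~ uniq [seq iter n sigma y | n <- iota 0 N].
  apply/negP => /max_poly_roots lt_N.
  have := lt_N (map_poly j h); rewrite size_map size_iota ltnn => F.
  suff : false by []. 
  apply: F; first by rewrite map_poly_eq0 separable_poly_neq0.
  by apply/allP => _ /mapP[n _ ->].
rewrite size_map size_iota => lt_n.
rewrite !(nth_map 0%N) ?size_iota ?(ltn_trans lt_mn) //
  !nth_iota ?(ltn_trans lt_mn) // !add0n.
rewrite -(subnKC lt_mn) addSnnS iterD => /it_inj Ey.
by exists (iter (n - m.+1) sigma y); rewrite -iterS.
Qed.

Lemma graph_hom_galois (G0 : set (Ksep * Ksep)) : graph_hom G0 ->
  exists2 sigma : {rmorphism Ksep -> Ksep}, galois_elt j sigma &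
    forall x y, G0 (x, y) -> sigma x = y.
Proof.
(* Joining [G0] inside [P] makes the empty chain harmless and forces the maximal element to extend
   [G0]. *)
move=> homG0; pose P : set (set (Ksep * Ksep)) := [set A | graph_hom (A `|` G0)].
have [F FP Ftot|A [homA A_max]] := @Zorn_bigcup _ P.
  have join2 z z' : (\bigcup_(X in F) X `|` G0) z ->
      (\bigcup_(X in F) X `|` G0) z' ->
      exists2 X, graph_hom (X `|` G0) /\ X `|` G0 `<=` \bigcup_(X in F) X `|` G0
        & (X `|` G0) z /\ (X `|` G0) z'.
    have subF X : F X -> X `|` G0 `<=` \bigcup_(X in F) X `|` G0.
      by move=> FX u [Xu|]; [left; exists X | right].
    move=> [[X FX Xz]|Gz] [[Y FY Yz']|Gz'].
    - have [XY|YX] := Ftot X Y FX FY.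
        by exists Y; [split; [exact: FP | exact: subF] | split; left; auto].
      by exists X; [split; [exact: FP | exact: subF] | split; left; auto].
    - by exists X; [split; [exact: FP | exact: subF] | split; [left | right]].
    - by exists Y; [split; [exact: FP | exact: subF] | split; [right | left]].
    - by exists set0; rewrite set0U; split=> // u; right.
  rewrite /P /=; split.
  - by move=> a; right; exact: (graph_const homG0).
  - move=> x y x' y' xy xy'; have [X [homX sX] [Xxy Xxy']] := join2 _ _ xy xy'.
    by apply: sX; apply: graph_sub.
  - move=> x y x' y' xy xy'; have [X [homX sX] [Xxy Xxy']] := join2 _ _ xy xy'.
    by apply: sX; apply: graph_mul.
  - move=> y xy; have [X [homX sX] [Xxy _]] := join2 _ _ xy xy.
    exact: graph_fun0 homX _ Xxy.
pose G := A `|` G0; have homG : graph_hom G by [].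
have G_total x : exists y, G (x, y).
  have [H1 [H2 [H12 [H1m sH2 H1_sep H2_sep] H1x ext]]] := graph_hom_extend homG x.
  have [|y H2y] := jP.2 H2 H2_sep.
    by rewrite sH2; apply: root_size_gt1 H1x; apply: monic_neq0.
  have [G' [homG' GG' G'xy]] := ext y H2y.
  apply: contrapT => nGx; apply: (A_max G').
    split; first by move=> u Au; apply: GG'; left.
    by move=> G'A; apply: nGx; exists y; left; apply: G'A.
  rewrite /P /=; have -> // : G' `|` G0 = G'.
  by apply/setUidPl => u G0u; apply: GG'; right.
have [s s_graph] := choice G_total.
have s_fun x y : G (x, y) -> s x = y by apply: graph_fun.
have sigma_add : zmod_morphism s.
  by move=> x y; apply: s_fun; apply: graph_sub.
have sigma_mul : monoid_morphism s.
  by split=> [|x y]; apply: s_fun; [apply: graph1 | apply: graph_mul].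
pose sA := GRing.isZmodMorphism.Build _ _ s sigma_add.
pose sM := GRing.isMonoidMorphism.Build _ _ s sigma_mul.
pose sigma : {rmorphism Ksep -> Ksep} := HB.pack s sA sM.
exists sigma; last by move=> x y xy; apply: s_fun; right.
by apply: sep_endo_galois => a; apply: s_fun; apply: graph_const.
Qed.

End SeparableClosure.

Lemma monic_size_le1 (R : nzRingType) (h : {poly R}) :
  h \is monic -> (size h <= 1)%N -> h = 1.
Proof.
by move=> + /size1_polyC E; rewrite E monicE lead_coefC => /eqP->.
Qed.

(** * Teichmueller elements, Frobenius and inertia *)

Section Unramified.
Variables (O : idomainType) (k : finFieldType) (rho : {rmorphism O -> k}).
Variable pi : O.
Hypothesis dvrO : complete_dvr rho pi.
Variables (K : fieldType) (iota : {rmorphism O -> K}).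
Hypothesis iotaP : is_fraction_field iota.
Variables (Ksep : fieldType) (j : {rmorphism K -> Ksep}).
Hypothesis jP : is_separable_closure j.
Local Notation q := #|k|.
Let g : {rmorphism O -> Ksep} := j \o iota.
Local Notation int := (integralOver g).
Local Notation int_max := (int_max g).
Local Notation "h ^j" := (map_poly j h) (at level 2, format "h ^j").
Local Notation "h ^g" := (map_poly g h) (at level 2, format "h ^g").

Let g_inj : injective g.
Proof. by move=> c d /fmorph_inj/iotaP.1. Qed.

Let saI := integral_subalgebra g.

(** Otherwise the inverse of [a] is a multiple of [pi] in [O], a non-unit of the integral closure,
    although [a] is integral. *)
Lemma integrally_closed a : int (j a) -> exists c, a = iota c.
Proof.
move=> [h h_mon hja].
have a_int : integralOver iota a.
  exists h => //; move: hja; rewrite !rootE.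
  by rewrite map_poly_comp horner_map fmorph_eq0.
have [c [d [d0 def_a]]] := iotaP.2 a.
have [[e def_c]|[e def_d]] := uniformizer_dvd_total dvrO c d.
  exists e; rewrite def_a def_c rmorphM mulrAC divff ?mul1r //.
  by rewrite -(rmorph0 iota) (inj_eq iotaP.1).
have [_ /(_ a a_int)/eqP[]] :=
  int_max_uniformizer iotaP.1 dvrO (integral_id iota e).
have [c0 pe0] : iota c != 0 /\ iota (pi * e) != 0.
  apply/andP; rewrite -negb_or -mulf_eq0 -rmorphM -def_d.
  by rewrite -(rmorph0 iota) (inj_eq iotaP.1).
by rewrite -rmorphM def_a def_d [iota (c * _)]rmorphM invfM mulVKf // divff.
Qed.

Lemma sep_splits (h : {poly Ksep}) : separable_poly h -> h \is monic ->
  exists2 rs, uniq rs & h = \prod_(r <- rs) ('X - r%:P).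
Proof.
move=> h_sep h_mon.
suff [rs E] : exists rs, h = \prod_(r <- rs) ('X - r%:P).
  by exists rs; rewrite // -separable_prod_XsubC -E.
have [n le_n] := ubnP (size h); elim: n => // n IHn in h h_sep h_mon le_n *.
have [le_h1|gt_h1] := leqP (size h) 1.
  by exists [::]; rewrite big_nil; apply: monic_size_le1.
have [r hr] := jP.2 h h_sep gt_h1.
have [h' def_h] := factor_theorem h r hr.
have h'_mon : h' \is monic by move: h_mon; rewrite def_h monicMr ?monicXsubC.
have [||rs E] := IHn h' _ h'_mon.
- by apply: dvdp_separable h_sep; rewrite def_h dvdp_mulr.
- by move: le_n; rewrite def_h size_Mmonic ?monicXsubC ?monic_neq0 //
    size_XsubC addn2.
by exists (r :: rs); rewrite big_cons -E mulrC.
Qed.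

(** The exponent [t.+1] excludes the empty condition w^(q^0) = w. *)
Definition teichmuller (w : Ksep) := exists t, w ^+ (q ^ t.+1) = w.

Lemma teichmuller_int w : teichmuller w -> int w.
Proof.
move=> [t wQ]; have Q_gt1 : (1 < q ^ t.+1)%N.
  by rewrite -{1}(exp1n t.+1) ltn_exp2r // finNzRing_gt1.
exists ('X^(q ^ t.+1) - 'X); last first.
  by rewrite rmorphB /= map_polyXn map_polyX rootE !hornerE wQ subrr.
by rewrite monicE lead_coefDl ?lead_coefXn // size_polyN size_polyX size_polyXn ltnS.
Qed.

(** Otherwise 1 = q^(t+1) would be a non-unit. This makes X^n - 1 separable for n = q^(t+1) - 1, so
    that primitive n-th roots of unity exist. *)
Lemma int_card_pred_neq0 t : ((q ^ t.+1).-1)%:R != 0 :> Ksep.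
Proof.
apply/eqP => n0; apply: (@int_max_neq1 _ _ g).
have := int_max_card g_inj dvrO t.
by rewrite -(prednK (expn_card_gt0 k t.+1)) -addn1 natrD n0 add0r.
Qed.

Lemma prim_root_exists t : exists z : Ksep, (q ^ t.+1).-1.-primitive_root z.
Proof.
have n0 := int_card_pred_neq0 t; set n := _.-1 in n0 *.
have n_gt0 : (0 < n)%N by case: n n0 => //; rewrite eqxx.
have [rs rs_uniq E] := sep_splits (separable_Xn_sub_1 n0) (monicXnsubC 1 n_gt0).
have : has n.-primitive_root rs.
  apply: has_prim_root => //.
    by apply/allP => r rs_r; rewrite /root_of_unity E root_prod_XsubC.
  by rewrite -ltnS -(size_prod_XsubC rs id) /= -E size_XnsubC.
by case/hasP=> z _ z_prim; exists z.
Qed.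

Lemma teichmuller_pow t (w z : Ksep) : (q ^ t.+1).-1.-primitive_root z ->
  w ^+ (q ^ t.+1) = w -> w = 0 \/ exists m, w = z ^+ m.
Proof.
move=> z_prim wQ; have [->|w0] := eqVneq w 0; [by left | right].
have [|i ->] := prim_rootP z_prim (x := w); last by exists i.
apply: (mulfI w0); rewrite mulr1 -exprS prednK ?expn_card_gt0 //.
Qed.

(** Both elements are 0 or powers of one primitive root of unity [z] of order q^(T+1) - 1, where T+1
    is a multiple of both periods. The polynomials are 0 or monomials, so they commute with q-th
    powers. *)
Lemma teichmuller_common w w' : teichmuller w -> teichmuller w' ->
  exists2 z, teichmuller z & exists h h' : {poly K},
    [/\ w = h^j.[z], w ^+ q = h^j.[z ^+ q], w' = h'^j.[z]
      & w' ^+ q = h'^j.[z ^+ q]].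
Proof.
move=> [t wQ] [t' w'Q]; pose T := (t.+1 * t'.+1).-1.
have TS : T.+1 = (t.+1 * t'.+1)%N by [].
have wT : w ^+ (q ^ T.+1) = w by rewrite TS expnM iter_expr_fixed.
have w'T : w' ^+ (q ^ T.+1) = w' by rewrite TS mulnC expnM iter_expr_fixed.
have [z z_prim] := prim_root_exists T.
have polyE u : u ^+ (q ^ T.+1) = u ->
    exists h : {poly K}, u = h^j.[z] /\ u ^+ q = h^j.[z ^+ q].
  case/(teichmuller_pow z_prim) => [->|[m ->]].
    exists 0; rewrite rmorph0 !horner0 expr0n gtn_eqF //.
    exact: ltnW (finNzRing_gt1 k).
  by exists 'X^m; rewrite map_polyXn !hornerXn exprAC.
exists z; first by exists T; rewrite -(prednK (expn_card_gt0 k T.+1)) exprS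
  prim_expr_order ?mulr1.
have [h [hw hwq]] := polyE w wT; have [h' [hw' hwq']] := polyE w' w'T.
by exists h, h'.
Qed.

Lemma min_poly_exists (z : Ksep) : exists h : {poly K},
  [/\ h \is monic, root h^j z & forall f : {poly K}, root f^j z -> h %| f].
Proof.
pose good n := exists h : {poly K}, [/\ h != 0, root h^j z & size h = n].
have ex_good : exists n, `[< good n >].
  have [h h_sep hz] := jP.1 z; exists (size h); apply/asboolP; exists h.
  by split=> //; apply: separable_poly_neq0.
case: (ex_minnP ex_good) => n /asboolP[h [h0 hz <-]] n_min.
have c0 : lead_coef h != 0 by rewrite lead_coef_eq0.
exists ((lead_coef h)^-1 *: h); split.
- by rewrite monicE lead_coefZ mulVf.
- by rewrite map_polyZ rootZ ?fmorph_eq0 ?invr_eq0.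
move=> f fz; rewrite dvdpZl ?invr_eq0 //; apply/modp_eq0P/eqP.
apply/negPn/negP => r0; have := ltn_modp f h; rewrite h0 ltnNge => /negP[].
apply: n_min; apply/asboolP; exists (f %% h); split=> //.
have := fz; rewrite {1}(divp_eq f h) rmorphD rmorphM /= !rootE !hornerE.
by rewrite (rootP hz) mulr0 add0r.
Qed.

Lemma int_coef_prod_XsubC (rs : seq Ksep) i :
  (forall r, r \in rs -> int r) -> int (\prod_(r <- rs) ('X - r%:P))`_i.
Proof.
elim: rs i => [|r rs IHrs] i rs_int.
  by rewrite big_nil coef1; apply: integral_nat.
rewrite big_cons mulrBl coefB coefXM mul_polyC coefZ.
have {}IHrs l : int (\prod_(r <- rs) ('X - r%:P))`_l.
  by apply: IHrs => r' rs_r'; apply: rs_int; rewrite inE rs_r' orbT.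
apply: integral_sub; first by case: eqP => _; [exact: integral0 | exact: IHrs].
by apply: integral_mul => //; apply: rs_int; rewrite inE eqxx.
Qed.

(* The minimal polynomial f of z has coefficients in O, so f(z^q) = f(z)^q = 0
   modulo the maximal ideal; the roots of f are Teichmueller elements, which
   are determined by their residues, so z^q is one of them. *)
Lemma teichmuller_conjugate z (h : {poly K}) :
  teichmuller z -> root h^j z -> root h^j (z ^+ q).
Proof.
move=> z_teich hz; have [f [f_mon fz f_min]] := min_poly_exists z.
have /dvdpP[u ->] := f_min h hz; rewrite rmorphM /= rootM; apply/orP; right.
have [h' h'_sep h'z] := jP.1 z.
have fj_mon : f^j \is monic by rewrite map_monic.
have [rs _ def_f] : exists2 rs, uniq rs & f^j = \prod_(r <- rs) ('X - r%:P).
  apply: sep_splits => //; rewrite separable_map.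
  exact: dvdp_separable (f_min _ h'z) h'_sep.
have rs_teich r : r \in rs -> teichmuller r.
  move=> rs_r; have [t zQ] := z_teich; exists t.
  have /f_min/dvdpP[v E] : root ('X^(q ^ t.+1) - 'X)^j z.
    by rewrite rmorphB /= map_polyXn map_polyX rootE !hornerE zQ subrr.
  have : root ('X^(q ^ t.+1) - 'X)^j r.
    by rewrite E rmorphM /= rootM def_f root_prod_XsubC rs_r orbT.
  rewrite rmorphB /= map_polyXn map_polyX rootE !hornerE subr_eq0.
  by move/eqP.
have /choice[F def_F] : forall i, exists c, f`_i = iota c.
  move=> i; apply: integrally_closed; rewrite -coef_map def_f.
  by apply: int_coef_prod_XsubC => r /rs_teich; apply: teichmuller_int.
pose f0 := \poly_(i < size f) F i.
have f0E : f0^g = f^j.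
  apply/polyP => i; rewrite !coef_map coef_poly def_F.
  case: ltnP => // le_i; rewrite -def_F nth_default //.
  exact: etrans (rmorph0 g) (esym (rmorph0 j)).
have z_int := teichmuller_int z_teich.
have zq_int : int (z ^+ q) by apply: (sa_exp saI).
have [b b_int] := horner_expr_card dvrO f0 saI z_int.
rewrite f0E (rootP fz) expr0n gtn_eqF ?(ltnW (finNzRing_gt1 k)) // subr0 expr1.
move=> fzq; have : int_max f^j.[z ^+ q].
  by rewrite fzq; apply: (int_max_uniformizer g_inj dvrO).
rewrite def_f horner_prod root_prod_XsubC.
(* The non-units form a prime ideal, so some factor z^q - r of the product lies in it; the induction
   finds that factor. *)
elim: rs rs_teich {def_f} => [|r rs IHrs] rs_teich.
  by rewrite big_nil => /int_max_neq1.
rewrite big_cons inE.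
have /int_max_prime H : int ('X - r%:P).[z ^+ q].
  rewrite hornerXsubC; apply: integral_sub => //; apply: teichmuller_int.
  by apply: rs_teich; rewrite inE eqxx.
case/H => {H}.
- rewrite -horner_prod; elim: rs {IHrs} rs_teich => [|r' rs IHrs] rs_teich.
    by rewrite big_nil hornerC; apply: integral1.
  rewrite big_cons hornerM; apply: integral_mul; last first.
    apply: IHrs => s; rewrite inE => /predU1P[->|rs_s]; apply: rs_teich.
      by rewrite inE eqxx.
    by rewrite !inE rs_s !orbT.
  rewrite hornerXsubC; apply: integral_sub => //; apply: teichmuller_int.
  by apply: rs_teich; rewrite !inE eqxx orbT.
- rewrite hornerXsubC => zr_max; apply/orP; left; apply/eqP.
  have [t' rQ] : teichmuller r by apply: rs_teich; rewrite inE eqxx.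
  have [t zQ] := z_teich.
  apply: (teichmuller_inj g_inj dvrO (t := t) (t' := t')) zr_max => //.
    by apply: teichmuller_int; exists t'.
  by rewrite exprAC zQ.
move/IHrs => -> //; first by rewrite orbT.
by move=> s rs_s; apply: rs_teich; rewrite inE rs_s orbT.
Qed.

(** The Frobenius automorphism of the maximal unramified extension, sending h(z) to h(z^q). That it
    is single-valued is [teichmuller_conjugate]. *)
Definition frobenius_graph : set (Ksep * Ksep) :=
  [set xy | exists2 z, teichmuller z & exists h : {poly K},
    xy.1 = h^j.[z] /\ xy.2 = h^j.[z ^+ q]].

Lemma frobenius_graph_common xy xy' :
    frobenius_graph xy -> frobenius_graph xy' ->
  exists2 z, teichmuller z & exists h h' : {poly K},
    [/\ xy.1 = h^j.[z], xy.2 = h^j.[z ^+ q], xy'.1 = h'^j.[z]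
      & xy'.2 = h'^j.[z ^+ q]].
Proof.
move=> [z z_t [h [-> ->]]] [z' z'_t [h' [-> ->]]].
have [w w_t [f [f' [-> -> -> ->]]]] := teichmuller_common z_t z'_t.
exists w => //; exists (h \Po f), (h' \Po f').
by rewrite !map_comp_poly !horner_comp.
Qed.

Lemma frobenius_graph_hom : graph_hom j frobenius_graph.
Proof.
split.
- move=> a; exists 1; first by exists 0; rewrite expr1n.
  by exists a%:P; rewrite map_polyC !hornerC.
- move=> x y x' y' xy xy'.
  have [z z_t [h [h' /= [-> -> -> ->]]]] := frobenius_graph_common xy xy'.
  by exists z => //; exists (h - h'); rewrite rmorphB !hornerE.
- move=> x y x' y' xy xy'.
  have [z z_t [h [h' /= [-> -> -> ->]]]] := frobenius_graph_common xy xy'.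
  by exists z => //; exists (h * h'); rewrite rmorphM !hornerE.
- move=> y [z z_t [h /= [hz ->]]]; apply/rootP; apply: teichmuller_conjugate => //.
  by apply/rootP.
Qed.

Lemma int_rmorph (sigma : {rmorphism Ksep -> Ksep}) x :
  (forall a, sigma (j a) = j a) -> int x -> int (sigma x).
Proof.
move=> sigmaK /(integral_rmorph sigma)[h h_mon hx]; exists h => //.
by move: hx; congr (root _ _); apply: eq_map_poly => c /=; rewrite sigmaK.
Qed.

(** The q-th power is additive modulo [pi], hence injective on residues. Congruences may thus be
    checked after raising to a q^i-th power, where [int_teichmuller] applies. *)
Lemma int_max_sub_expr i a b : int a -> int b ->
  int_max (a ^+ (q ^ i) - b ^+ (q ^ i)) -> int_max (a - b).
Proof.
elim: i a b => [|i IHi] a b a_int b_int; first by rewrite !expr1.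
rewrite !expnS !exprM => /IHi H.
have {H} ab_max : int_max (a ^+ q - b ^+ q) by apply: H; apply: (sa_exp saI).
have d_int : int (a - b) by apply: integral_sub.
apply: (int_max_expr (n := q)) => //.
have [z z_int] := exprD_card saI dvrO (x := b) (y := a - b) b_int d_int.
rewrite addrC subrK => E.
have -> : (a - b) ^+ q = a ^+ q - b ^+ q - g pi * ((a - b) * z) by rewrite E; ring.
apply: (int_maxB g_inj dvrO) => //; apply: (int_max_uniformizer g_inj dvrO).
exact: integral_mul.
Qed.

(** An extension of [frobenius_graph] to [Ksep] is a Frobenius element: a q^i-th power of any
    integral element is a Teichmueller element plus a multiple of [pi], and on the former the
    congruence is an equality. *)
Lemma frobenius_exists : exists2 sigma, frobenius_elt iota j q sigma &
  forall w, teichmuller w -> sigma w = w ^+ q.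
Proof.
have [sigma sigma_gal sigma_graph] := graph_hom_galois jP frobenius_graph_hom.
have sigmaW w : teichmuller w -> sigma w = w ^+ q.
  move=> w_t; apply: sigma_graph; exists w => //; exists 'X.
  by rewrite /= map_polyX !hornerX.
exists sigma => //; split=> // x x_int.
have sigma_g c : sigma (g c) = g c by rewrite /= sigma_gal.2.
have [i [t [w [b [w_int b_int wQ xw]]]]] := int_teichmuller g_inj dvrO x_int.
have sb_int := int_rmorph sigma_gal.2 b_int.
apply: (int_max_sub_expr (i := i)).
- exact: int_rmorph sigma_gal.2 _.
- exact: (sa_exp saI).
rewrite -rmorphXn exprAC xw rmorphD rmorphM sigma_g sigmaW; last by exists t.
have [z z_int ->] := exprD_card saI dvrO w_int
  (integral_mul (integral_id g pi) b_int).
have -> : w ^+ q + g pi * sigma b - (w ^+ q + (g pi * b) ^+ q + g pi * (g pi * b * z))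
  = g pi * sigma b - ((g pi * b) ^+ q + g pi * (g pi * b * z)) by ring.
apply: (int_maxB g_inj dvrO); first exact: (int_max_uniformizer g_inj dvrO).
apply: (int_maxD g_inj dvrO); last first.
  by apply: (int_max_uniformizer g_inj dvrO); apply: integral_mul => //;
    apply: integral_mul => //; apply: integral_id.
rewrite -(ltn_predK (finNzRing_gt1 k)) exprS mulrC; apply: int_max_mul.
  by apply: (sa_exp saI); apply: integral_mul => //; apply: integral_id.
exact: (int_max_uniformizer g_inj dvrO).
Qed.

(** If [x] is outside the domain of [frobenius_graph], its minimal polynomial over that field has
    another root [y], by separability. The identity of the field extends to an automorphism sending
    [x] to [y]. It fixes all Teichmueller elements, hence acts trivially on residues and belongs to
    inertia. *)
Lemma inertia_fixed x :
    (forall sigma, inertia_elt iota j sigma -> sigma x = x) ->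
  exists y, frobenius_graph (x, y).
Proof.
move=> x_fixed; apply: contrapT => x_nunr.
pose G : set (Ksep * Ksep) :=
  [set uv | uv.1 = uv.2 /\ exists y, frobenius_graph (uv.1, y)].
have homG : graph_hom j G.
  have homF := frobenius_graph_hom.
  split=> /=.
  - by move=> a; split=> //; exists (j a); apply: (graph_const homF).
  - move=> u v u' v' [/= <- [y uy]] [/= <- [y' uy']]; split=> //=.
    by exists (y - y'); apply: (graph_sub homF).
  - move=> u v u' v' [/= <- [y uy]] [/= <- [y' uy']]; split=> //=.
    by exists (y * y'); apply: (graph_mul homF).
  - by move=> y [].
have [H1 [H2 [H12 [H1m _ H1_sep _] H1x ext]]] := graph_hom_extend jP homG x.
have def_H2 : H2 = H1 by apply/polyP => i; case: (H12 i) => /= ->.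
rewrite {H2}def_H2 in H12 ext.
have [H' def_H] := factor_theorem H1 x H1x.
have H'm : H' \is monic by move: H1m; rewrite def_H monicMr ?monicXsubC.
have [sH'|sH'] := leqP (size H') 1.
  apply: x_nunr; have H'1 : H' = 1 by apply: monic_size_le1.
  have [/= _ [y xy]] := H12 0; exists (0 - y).
  rewrite -[x]opprK -sub0r; apply: (graph_sub frobenius_graph_hom).
    exact: (graph0 frobenius_graph_hom).
  by move: xy; rewrite def_H H'1 mul1r coefB coefX coefC sub0r.
have H'_sep : separable_poly H'.
  by apply: dvdp_separable H1_sep; rewrite def_H dvdp_mulr.
have [y H'y] := jP.2 H' H'_sep sH'.
have neq_xy : y != x.
  apply/eqP => yx; move: H1_sep; rewrite def_H separable_mul.
  case/and3P => _ _; rewrite coprimep_XsubC -yx.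
  by rewrite H'y.
have [|G' [homG' GG' G'xy]] := ext y; first by rewrite def_H rootM H'y.
have [sigma sigma_gal sigma_graph] := graph_hom_galois jP homG'.
case/eqP: neq_xy; rewrite -(sigma_graph _ _ G'xy); apply: x_fixed.
split=> // u u_int.
have sigma_g c : sigma (g c) = g c by rewrite /= sigma_gal.2.
have [i [t [w [b [w_int b_int wQ uw]]]]] := int_teichmuller g_inj dvrO u_int.
have sb_int := int_rmorph sigma_gal.2 b_int.
apply: (int_max_sub_expr (i := i)) => //; first exact: int_rmorph sigma_gal.2 _.
rewrite -rmorphXn uw rmorphD rmorphM sigma_g.
have -> : sigma w = w.
  apply: sigma_graph; apply: GG'; split=> //=; exists (w ^+ q), w; first by exists t.
  by exists 'X; rewrite map_polyX !hornerX.
rewrite opprD addrACA subrr add0r -mulrBr.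
by apply: (int_max_uniformizer g_inj dvrO); apply: integral_sub.
Qed.

End Unramified.

(** * Points of a finite étale algebra *)

Section Etale.
Variables (K Ksep : fieldType) (j : {rmorphism K -> Ksep}).
Hypothesis jP : is_separable_closure j.

Lemma sep_embedding (L : fieldExtType K) : separable 1%VS {:L}%VS ->
  exists f : {rmorphism L -> Ksep}, forall a, f a%:A = j a.
Proof.
move=> L_sep; pose al := separable_generator 1%VS {:L}%VS.
have genL x : x \in <<1%VS; al>>%VS.
  by rewrite -(eq_adjoin_separable_generator L_sep (subvf _)) memvf.
have /polyOver1P[h def_h] := minPolyOver 1%AS al.
have h_root : root (map_poly (in_alg L) h) al by rewrite -def_h root_minPoly.
have h_sep : separable_poly h.
  rewrite -(separable_map (in_alg L)) -def_h.
  exact: (separable_generatorP {:L}%AS 1%AS).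
have [||b hb] := jP.2 (map_poly j h) _ _; first by rewrite separable_map.
  rewrite size_map_poly -(size_map_poly (in_alg L)); apply: root_size_gt1 h_root.
  by rewrite map_poly_eq0 separable_poly_neq0.
have polyE x : exists f : {poly K}, x = (map_poly (in_alg L) f).[al].
  have /polyOver1P[f def_f] := Fadjoin_polyOver 1%AS al x.
  by exists f; rewrite -def_f Fadjoin_poly_eq.
have horner0 (f : {poly K}) :
    (map_poly (in_alg L) f).[al] = 0 -> (map_poly j f).[b] = 0.
  move=> /rootP f_root; have : map_poly (in_alg L) h %| map_poly (in_alg L) f.
    by rewrite -def_h; apply: minPoly_dvdp => //; apply/polyOver1P; exists f.
  rewrite dvdp_map => /dvdpP[u ->]; rewrite rmorphM hornerM.
  by rewrite (rootP hb) mulr0.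
have horner_eq (f f' : {poly K}) :
    (map_poly (in_alg L) f).[al] = (map_poly (in_alg L) f').[al] ->
    (map_poly j f).[b] = (map_poly j f').[b].
  move=> E; apply: subr0_eq; rewrite -hornerN -hornerD -rmorphB.
  by apply: horner0; rewrite rmorphB hornerD hornerN E subrr.
have [P defP] := choice polyE.
pose s x := (map_poly j (P x)).[b].
have sE x f : x = (map_poly (in_alg L) f).[al] -> s x = (map_poly j f).[b].
  by move=> def_x; apply: horner_eq; rewrite -defP.
have s_add : zmod_morphism s.
  move=> x y; rewrite (sE _ (P x - P y)) ?rmorphB ?hornerD ?hornerN //.
  by rewrite -!defP.
have s_mul : monoid_morphism s.
  split=> [|x y]; first by rewrite (sE _ 1) rmorph1 hornerC.
  by rewrite (sE _ (P x * P y)) ?rmorphM ?hornerM // -!defP.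
pose sA := GRing.isZmodMorphism.Build _ _ s s_add.
pose sM := GRing.isMonoidMorphism.Build _ _ s s_mul.
exists (HB.pack_for {rmorphism L -> Ksep} s sA sM) => a /=.
by rewrite (sE _ a%:P) map_polyC hornerC.
Qed.

Variables (E : comPzRingType) (eta : {rmorphism K -> E}).
Hypothesis E_etale : finite_etale eta.

Lemma etale_span : exists d (e : 'I_d -> E),
  forall x, exists a : 'I_d -> K, x = \sum_i eta (a i) * e i.
Proof.
have [n [L [pr [_ prK pr_bij]]]] := E_etale.
have pr_inj x y : (forall i, pr i x = pr i y) -> x = y.
  move=> xy; have [z [_ z_uniq]] := pr_bij (fun i => pr i y).
  by rewrite -(z_uniq x) // -(z_uniq y).
have unitE i (v : L i) :
    exists x, pr i x = v /\ forall i', i' != i -> pr i' x = 0.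
  have [x [Ex _]] := pr_bij (dfwith (fun i' => 0 : L i') v).
  exists x; rewrite Ex dfwith_in; split=> // i' neq_i'.
  by rewrite Ex dfwith_out // eq_sym.
pose I : finType := {i : 'I_n & 'I_(\dim {:L i})}.
have /choice[e def_e] : forall t : I, exists x,
    pr (tag t) x = (vbasis {:L (tag t)})`_(tagged t) /\
    forall i', i' != tag t -> pr i' x = 0.
  by move=> t; apply: unitE.
exists #|I|, (fun t => e (enum_val t)) => x.
pose tg i l : I := Tagged (fun i => 'I_(\dim {:L i})) (l : 'I_(\dim {:L i})).
pose a (t : I) : K := coord (vbasis {:L (tag t)}) (tagged t) (pr (tag t) x).
exists (fun t => a (enum_val t)).
rewrite -(sum_enum_val (fun t => eta (a t) * e t)).
have -> : \sum_(t : I) eta (a t) * e t =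
    \sum_i \sum_(l < \dim {:L i}) eta (a (tg _ l)) * e (tg _ l).
  by rewrite (sig_big_dep _ (fun=> xpredT)) /=; apply: eq_bigr => -[i l].
apply: pr_inj => i; rewrite rmorph_sum (bigD1 i) //= [X in _ + X]big1.
  rewrite addr0 rmorph_sum {1}(coord_vbasis (memvf (pr i x))).
  apply: eq_bigr => l _; rewrite rmorphM prK (def_e (tg _ l)).1.
  by rewrite mulr_algl.
move=> i' neq_i'; rewrite rmorph_sum big1 // => l _; rewrite rmorphM.
by rewrite (def_e (tg _ l)).2 ?mulr0 // eq_sym.
Qed.

Lemma etale_separated x : (forall s, points j eta s -> s x = 0) -> x = 0.
Proof.
have [n [L [pr [L_sep prK pr_bij]]]] := E_etale => sx0.
have [z [_ z_uniq]] := pr_bij (fun i => 0).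
rewrite -(z_uniq x) ?(z_uniq 0) // => i; first by rewrite rmorph0.
have [f f_alg] := sep_embedding (L_sep i).
apply/eqP; rewrite -(fmorph_eq0 f); apply/eqP.
by apply: (sx0 (f \o pr i)) => a /=; rewrite prK f_alg.
Qed.

Lemma roots_finite (F : fieldType) (h : {poly F}) : h != 0 ->
  exists rs : seq F, forall x, root h x -> x \in rs.
Proof.
have [n le_n] := ubnP (size h); elim: n => // n IHn in h le_n *.
move=> h0; have [[r hr]|h_noroot] := pselect (exists r, root h r); last first.
  by exists [::] => x hx; case: h_noroot; exists x.
have [h' def_h] := factor_theorem h r hr; rewrite def_h in h0 le_n *.
have h'0 : h' != 0 by apply: contraNneq h0 => ->; rewrite mul0r.
have [|rs rsP] := IHn h' _ h'0.
  by move: le_n; rewrite size_Mmonic ?monicXsubC // size_XsubC addn2.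
exists (r :: rs) => x; rewrite rootM root_XsubC inE orbC.
by case/orP=> [->//|/rsP->]; rewrite orbT.
Qed.

(** The d+1 powers 1, ..., x^d lie in the span of d elements, so [x] satisfies a nonzero polynomial
    over [K], and so does its image under every point. *)
Lemma etale_values_finite x :
  exists rs : seq Ksep, forall s, points j eta s -> s x \in rs.
Proof.
have [d [e e_gen]] := etale_span.
have /choice[c def_c] : forall n : 'I_d.+1, exists c : 'I_d -> K,
    x ^+ n = \sum_i eta (c i) * e i by move=> n; apply: e_gen.
pose M : 'M[K]_(d.+1, d) := \matrix_(n, i) c n i.
have : kermx M != 0.
  by rewrite kermx_eq0 -row_leq_rank -ltnNge ltnS rank_leq_col.
rewrite -nz_row_eq0; set v := nz_row _ => v0.
have vM : v *m M = 0 by apply/sub_kermxP/nz_row_sub.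
pose h := \poly_(n < d.+1) v 0 (inord n).
have h0 : h != 0.
  apply: contraNneq v0 => h0; apply/eqP/rowP => n; rewrite mxE.
  have /(congr1 (fun h : {poly K} => h`_n)) := h0.
  by rewrite coef_poly ltn_ord coef0 inord_val.
have hj0 : map_poly j h != 0 by rewrite map_poly_eq0.
have [rs rsP] := roots_finite hj0; exists rs => s s_pt; apply: rsP.
apply/rootP; rewrite (@horner_coef_wide _ d.+1); last first.
  by rewrite size_map_poly size_poly.
rewrite (eq_bigr (fun n : 'I_d.+1 => \sum_i s (eta (v 0 n * M n i) * e i))).
  rewrite exchange_big big1 //= => i _; rewrite -rmorph_sum -mulr_suml -rmorph_sum.
  by have /rowP/(_ i) := vM; rewrite !mxE => ->; rewrite rmorph0 mul0r rmorph0.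
move=> n _; rewrite coef_map coef_poly ltn_ord inord_val /= -s_pt -rmorphXn def_c.
rewrite rmorph_sum mulr_sumr; apply: eq_bigr => i _.
by rewrite mxE !rmorphM mulrA.
Qed.

(** A point is determined by its values on a spanning family, and each of them lies in a finite
    list. The points are enumerated up to pointwise equality. *)
Lemma etale_points_finite : exists r (T : 'I_r -> {rmorphism E -> Ksep}),
  (forall i, points j eta (T i)) /\
  forall s, points j eta s -> exists i, s =1 T i.
Proof.
have [d [e e_gen]] := etale_span.
have /choice[rs rsP] : forall i, exists rs : seq Ksep,
    forall s, points j eta s -> s (e i) \in rs.
  by move=> i; apply: etale_values_finite.
pose m := \sum_i size (rs i).
pose code (s : {rmorphism E -> Ksep}) : {ffun 'I_d -> 'I_m.+1} :=
  [ffun i => inord (index (s (e i)) (rs i))].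
have code_inj s s' : points j eta s -> points j eta s' ->
    code s = code s' -> s =1 s'.
  move=> s_pt s'_pt /ffunP ss' x; have [a ->] := e_gen x.
  rewrite !rmorph_sum; apply: eq_bigr => i _; rewrite !rmorphM s_pt s'_pt.
  congr (_ * _); have := ss' i; rewrite !ffunE => /(congr1 val) /=.
  have lt_index t : points j eta t -> (index (t (e i)) (rs i) < m.+1)%N.
    move=> t_pt; rewrite ltnS (leq_trans (index_size _ _)) //.
    by rewrite /m (bigD1 i) //= leq_addr.
  rewrite !inordK ?lt_index // => /(congr1 (nth 0 (rs i))).
  by rewrite !nth_index ?rsP.
pose C : {set {ffun 'I_d -> 'I_m.+1}} :=
  finset (fun c => `[< exists2 s, points j eta s & code s = c >]).
have /choice[T TP] : forall i : 'I_#|C|, exists s : {rmorphism E -> Ksep},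
    points j eta s /\ code s = enum_val i.
  move=> i; have := enum_valP i; rewrite inE => /asboolP[s s_pt Es].
  by exists s.
exists #|C|, T; split=> [i|s s_pt]; first exact: (TP i).1.
have Cs : code s \in C by rewrite inE; apply/asboolP; exists s.
exists (enum_rank_in Cs (code s)); apply: code_inj => //; first exact: (TP _).1.
by rewrite (TP _).2 enum_rankK_in.
Qed.

Variable psi : {rmorphism E -> E}.
Hypothesis psiK : forall a, psi (eta a) = eta a.

Fixpoint rmorph_iter n : {rmorphism E -> E} :=
  if n is n'.+1 then psi \o rmorph_iter n' else idfun.

Lemma rmorph_iterE n : rmorph_iter n =1 iter n psi.
Proof. by elim: n => [|n IHn] x //; rewrite iterS -IHn. Qed.

Lemma rmorph_iterK n a : rmorph_iter n (eta a) = eta a.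
Proof. by rewrite rmorph_iterE; elim: n => //= n ->. Qed.

Lemma points_iter s n : points j eta s -> points j eta (s \o rmorph_iter n).
Proof. by move=> s_pt a /=; rewrite rmorph_iterK s_pt. Qed.

Lemma points_galois s (sigma : {rmorphism Ksep -> Ksep}) :
  (forall a, sigma (j a) = j a) -> points j eta s -> points j eta (sigma \o s).
Proof. by move=> sigmaK s_pt a /=; rewrite s_pt sigmaK. Qed.

(** Among s, s psi, ..., s psi^r two points agree, say at m < n. The factorial of r+1 is at least m
    and divisible by n - m, whatever [s] is, so it serves for all points at once. *)
Lemma psi_idempotent_power : exists2 N, (0 < N)%N &
  forall x, iter N psi (iter N psi x) = iter N psi x.
Proof.
have [r [T [T_pt T_all]]] := etale_points_finite.
exists (r.+1)`! => [|x]; first exact: fact_gt0.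
apply: subr0_eq; apply: etale_separated => s s_pt; rewrite rmorphB.
have /choice[c cP] : forall n : 'I_r.+1, exists i, s \o rmorph_iter n =1 T i.
  by move=> n; apply: T_all; apply: points_iter.
have /injectivePn[m [n neq_mn Ec]] : ~~ injectiveb c.
  by apply/negP => /injectiveP/leq_card; rewrite !card_ord ltnn.
wlog lt_mn : m n neq_mn Ec / (m < n)%N.
  move=> H; have /orP[lt_mn|lt_nm] : (m < n)%N || (n < m)%N by rewrite -neq_ltn.
    exact: (H m n).
  by apply: (H n m) => //; rewrite eq_sym.
have Emn y : s (iter m psi y) = s (iter n psi y).
  by rewrite -!rmorph_iterE; apply: etrans (cP m y) _; rewrite Ec -(cP n y).
have E1 l y : (m <= l)%N -> s (iter (l + (n - m)) psi y) = s (iter l psi y).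
  move=> le_ml; rewrite -(subnKC le_ml) addnAC (subnKC (ltnW lt_mn)).
  by rewrite !iterD -Emn.
have E2 t l y : (m <= l)%N -> s (iter (l + t * (n - m)) psi y) = s (iter l psi y).
  move=> le_ml; elim: t => [|t IHt]; first by rewrite addn0.
  by rewrite mulSnr addnA E1 ?IHt // (leq_trans le_ml) ?leq_addr.
have /dvdnP[t def_t] : (n - m %| (r.+1)`!)%N.
  by rewrite dvdn_fact // subn_gt0 lt_mn (leq_trans (leq_subr _ _)) // ltnW.
rewrite -iterD {2}def_t E2 ?subrr //.
by rewrite (leq_trans (ltnW (ltn_ord m))) // fact_geq.
Qed.
End Etale.

(** * Necessity: congruent periodic points of an algebra with a model *)

(** Nakayama's lemma by elimination: 1 - mu_00 is a unit, so v_0 can be solved for, and substituting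
    it leaves a smaller system of the same kind. *)
Lemma max_linear_system (O : idomainType) (L : fieldType)
    (g : {rmorphism O -> L}) (g_inj : injective g) (k : finFieldType)
    (rho : {rmorphism O -> k}) (pi : O) (dvrO : complete_dvr rho pi)
    n (v : 'I_n -> L) (mu : 'I_n -> 'I_n -> L) :
    (forall i l, int_max g (mu i l)) ->
    (forall i, v i = \sum_l mu i l * v l) ->
  forall i, v i = 0.
Proof.
elim: n v mu => [|n IHn] v mu mu_max def_v; first by case.
have [c c_int Ec] := one_sub_max_unit g_inj dvrO (mu_max ord0 ord0).
have v0E : v ord0 = c * \sum_l mu ord0 (lift ord0 l) * v (lift ord0 l).
  have := def_v ord0; rewrite big_ord_recl /= => /eqP.
  rewrite addrC -subr_eq -{1}[v ord0]mul1r -mulrBl => /eqP <-.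
  by rewrite mulrA [c * _]mulrC Ec mul1r.
have v_lift : forall i, v (lift ord0 i) = 0.
  apply: (IHn _ (fun i l => mu (lift ord0 i) (lift ord0 l) +
    mu (lift ord0 i) ord0 * (c * mu ord0 (lift ord0 l)))).
    move=> i l; apply: (int_maxD g_inj dvrO) => //.
    by rewrite mulrA; apply: int_max_mul => //; apply: integral_mul => //;
      case: (mu_max (lift ord0 i) ord0).
  move=> i; rewrite {1}def_v big_ord_recl /= v0E !mulr_sumr -big_split /=.
  by apply: eq_bigr => l _; ring.
move=> i; case: (unliftP ord0 i) => [l ->|->]; first exact: v_lift.
by rewrite v0E big1 ?mulr0 // => l _; rewrite v_lift mulr0.
Qed.

Section Lambda.
Variables (O : idomainType) (p : set O) (O_dvr : is_dvr p).
Variables (k : finFieldType) (rho : {rmorphism O -> k}) (pi : O).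
Hypotheses (def_p : p = principal pi) (dvrO : complete_dvr rho pi).
Variables (K : fieldType) (iota : {rmorphism O -> K}).
Hypothesis iotaP : is_fraction_field iota.
Variables (Ksep : fieldType) (j : {rmorphism K -> Ksep}).
Hypothesis jP : is_separable_closure j.
Variables (E : comPzRingType) (eta : {rmorphism K -> E}).
Hypothesis E_etale : finite_etale eta.
Variable psi : {rmorphism E -> E}.
Local Notation q := #|k|.
Hypothesis psiP : lambda_structure (eta \o iota) p q setT psi.

Let f : {rmorphism O -> E} := eta \o iota.
Let g : {rmorphism O -> Ksep} := j \o iota.

Let g_inj : injective g.
Proof. by move=> c d /fmorph_inj/iotaP.1. Qed.

Lemma lambda_psiK a : psi (eta a) = eta a.
Proof.
have [_ _ psi_lin _] := psiP.
have psi_iota c : psi (eta (iota c)) = eta (iota c).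
  by have := psi_lin c 1 Logic.I; rewrite rmorph1 mulr1.
have [c [d [d0 ->]]] := iotaP.2 a.
have d0' : iota d != 0 by rewrite -(rmorph0 iota) (inj_eq iotaP.1).
have da : iota d * (iota c / iota d) = iota c by rewrite mulrCA divff ?mulr1.
set a' := iota c / iota d in da *.
have E_K x : x = eta (iota d)^-1 * (eta (iota d) * x).
  by rewrite mulrA -rmorphM mulVf // rmorph1 mul1r.
rewrite [LHS]E_K [RHS]E_K; congr (_ * _).
by rewrite -{1}psi_iota -!rmorphM da psi_iota.
Qed.

Lemma point_scalar s c x : points j eta s -> s (f c * x) = g c * s x.
Proof. by move=> s_pt; rewrite rmorphM /= s_pt. Qed.

Lemma points_unrP N s : (0 < N)%N ->
    (forall x, iter N psi (iter N psi x) = iter N psi x) ->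
  points_unr p j eta psi s <->
  points j eta s /\ forall x, s (iter N psi x) = s x.
Proof.
move=> N_gt0 psiN; have expE n : ideal_exp p n = principal (pi ^+ n).
  by rewrite def_p ideal_exp_principal.
split=> [s_unr | [s_pt s_per] a [a_ideal a_neq0]].
  have pN_nz : nonzero_ideal (ideal_exp p N).
    rewrite expE; split; first exact: principal_ideal.
    move=> /seteqP[/(_ (pi ^+ N))]; rewrite /= => piN _.
    have := uniformizer_expr_neq0 dvrO N; rewrite piN ?eqxx //.
    by exists 1; rewrite mul1r.
  have [s_pt [s0 s0_pt [n pNn s_s0]]] := s_unr _ pN_nz; split=> // x.
  (* The exponent provided by [ideal_acts] is [N] itself, since the powers of p are distinct. *)
  suff Nn : N = n by rewrite !s_s0 /= -Nn psiN.
  have dvdE m l : ideal_exp p m = ideal_exp p l -> (l <= m)%N.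
    rewrite !expE => E_ml; have : principal (pi ^+ m) (pi ^+ m).
      by exists 1; rewrite mul1r.
    rewrite E_ml => -[u def_m].
    by apply: (uniformizer_exp_inj dvrO (u := u)); rewrite def_m mulrC.
  by apply/eqP; rewrite eqn_leq !dvdE.
have [pid _ _] := O_dvr; have [h def_a] := pid a a_ideal.
have h0 : h != 0.
  apply/eqP => h0; apply: a_neq0; rewrite def_a h0; apply/seteqP.
  split=> x /=; first by case=> c ->; rewrite mulr0.
  by move=> ->; exists 0; rewrite mul0r.
have [n [u [u_unit def_h]]] := factor_uniformizer dvrO h0.
(* As N > 0, this point is defined, and composing it with psi^n gives s psi^(N n) = s. *)
split=> //; exists (s \o rmorph_iter psi (N * n - n)).
  by apply: points_iter => //; exact: lambda_psiK.
exists n.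
  rewrite expE def_a def_h; apply/seteqP; split=> _ [c ->].
    by exists (c * u); rewrite -mulrA [u * _]mulrC.
  by exists (c * u^-1); rewrite [pi ^+ n * u]mulrC -mulrA mulKr.
move=> x /=; rewrite rmorph_iterE -iterD subnK ?leq_pmull //.
elim: {1}n => [|m IHm]; first by rewrite muln0.
by rewrite mulnS iterD s_per.
Qed.

Section Model.
Variable A : set E.
Hypothesis A_model : integral_lambda_model p q iota eta psi A.

Let saA : subalgebra f A. Proof. by case: A_model. Qed.

Lemma model_point_int s x : points j eta s -> A x -> integralOver g (s x).
Proof.
move=> s_pt Ax; apply: (@finite_integral _ _ _ (s @` A)); last by exists x.
  split.
  - by exists 1; [exact: (sa1 saA) | rewrite rmorph1].
  - move=> _ _ [y Ay <-] [z Az <-].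
    by exists (y - z); [exact: (sa_sub saA) | rewrite rmorphB].
  - move=> _ _ [y Ay <-] [z Az <-].
    by exists (y * z); [exact: (sa_mul saA) | rewrite rmorphM].
  - move=> c _ [y Ay <-].
    by exists (f c * y); [exact: (sa_scale saA) | rewrite point_scalar].
have [_ [[n [e [Ae e_gen]]] _] _ _] := A_model.
exists n, (fun i => s (e i)); split=> [i|_ [y /e_gen[c ->] <-]].
  by exists (e i).
exists c; rewrite rmorph_sum; apply: eq_bigr => i _; exact: point_scalar.
Qed.

Lemma model_frobenius_lift x : A x ->
  exists2 y, A y & psi x = x ^+ q + f pi * y.
Proof.
have [_ _ _ [_ _ _ psi_frob]] := A_model.
move=> /psi_frob[n [c [e [c_p Ae def_x]]]].
have /choice[d def_c] : forall i, exists d, c i = pi * d.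
  by move=> i; have := c_p i; rewrite def_p => -[d ->]; exists d; rewrite mulrC.
exists (\sum_i f (d i) * e i).
  by apply: (sa_sum saA) => i _; apply: (sa_scale saA).
rewrite -[psi x](subrK (x ^+ q)) def_x addrC mulr_sumr; congr (_ + _).
by apply: eq_bigr => i _; rewrite mulrA -rmorphM -def_c.
Qed.

(* With d = s - s', the relation psi x = x^q mod pi makes d(psi x) a
   combination of the values of d with coefficients in the maximal ideal; both
   points being periodic, so is every value of d, which then vanishes. *)
Lemma congruent_points_eq N s s' : (0 < N)%N ->
    points j eta s -> points j eta s' ->
    (forall x, s (iter N psi x) = s x) ->
    (forall x, s' (iter N psi x) = s' x) ->
    (forall x, A x -> int_max g (s x - s' x)) ->
  s =1 s'.
Proof.
move=> N_gt0 s_pt s'_pt sN s'N ss'_max.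
have [_ [[n [e [Ae e_gen]]] _] A_span [_ psiA _ _]] := A_model.
pose d x := s x - s' x.
have dE x : A x -> exists c : 'I_n -> O, d x = \sum_i g (c i) * d (e i).
  move=> /e_gen[c ->]; exists c; rewrite /d !rmorph_sum -sumrB.
  by apply: eq_bigr => i _; rewrite !point_scalar // mulrBr.
have d_psi x : A x -> exists mu : 'I_n -> Ksep,
    (forall i, int_max g (mu i)) /\ d (psi x) = \sum_i mu i * d (e i).
  move=> Ax; have [y Ay def_x] := model_frobenius_lift Ax.
  have q_max : int_max g q%:R by rewrite -(expn1 q); exact: (int_max_card g_inj dvrO 0).
  have [m m_max Em] := int_max_subXX g_inj dvrO q_max (model_point_int s_pt Ax)
    (model_point_int s'_pt Ax) (ss'_max x Ax).
  have [c dx] := dE x Ax; have [c' dy] := dE y Ay.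
  exists (fun i => g (c i) * m + g pi * g (c' i)); split=> [i|].
    apply: (int_maxD g_inj dvrO).
      by apply: int_max_mul => //; apply: integral_id.
    by apply: (int_max_uniformizer g_inj dvrO); apply: integral_id.
  have -> : d (psi x) = d x * m + g pi * d y.
    rewrite /d -Em def_x !rmorphD !rmorphXn !point_scalar //; ring.
  rewrite dx dy mulr_suml mulr_sumr -big_split /=.
  by apply: eq_bigr => i _; ring.
have A_iter l x : A x -> A (iter l psi x).
  by move=> Ax; elim: l => //= l; apply: psiA.
have /choice[mu mu_d] : forall i, exists mu : 'I_n -> Ksep,
    (forall l, int_max g (mu l)) /\ d (e i) = \sum_l mu l * d (e l).
  (* Only the last of the [N] applications of [psi] is used to get coefficients in the maximal
     ideal; periodicity turns psi^N (e i) back into e i. *)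
  move=> i; have [|mu [mu_max Emu]] := d_psi (iter N.-1 psi (e i)).
    exact: A_iter.
  exists mu; split=> //; rewrite -Emu -iterS prednK //.
  by rewrite /d sN s'N.
have d0 : forall i, d (e i) = 0.
  apply: (max_linear_system g_inj dvrO) => [i l|i]; first exact: (mu_d i).1.
  exact: (mu_d i).2.
have dA x : A x -> d x = 0.
  by move=> /dE[c ->]; rewrite big1 // => i _; rewrite d0 mulr0.
move=> x; have [m [a [b [Ab ->]]]] := A_span x.
rewrite !rmorph_sum; apply: eq_bigr => i _; rewrite !rmorphM s_pt s'_pt.
by congr (_ * _); apply: subr0_eq; apply: dA.
Qed.

Lemma model_inertia sigma s : inertia_elt iota j sigma ->
  points_unr p j eta psi s -> sigma \o s =1 s.
Proof.
move=> [[_ sigmaK] sigma_max] s_unr.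
have [N N_gt0 psiN] := psi_idempotent_power jP E_etale lambda_psiK.
have [s_pt sN] := (points_unrP s N_gt0 psiN).1 s_unr.
apply: (congruent_points_eq N_gt0) => //.
- exact: points_galois.
- by move=> x /=; rewrite sN.
- by move=> x Ax; apply: sigma_max; apply: model_point_int.
Qed.

Lemma model_frobenius sigma s : frobenius_elt iota j q sigma ->
  points_unr p j eta psi s -> sigma \o s =1 s \o psi.
Proof.
move=> [[_ sigmaK] sigma_max] s_unr.
have [N N_gt0 psiN] := psi_idempotent_power jP E_etale lambda_psiK.
have [s_pt sN] := (points_unrP s N_gt0 psiN).1 s_unr.
apply: (congruent_points_eq (s' := s \o psi) N_gt0) => //.
- exact: points_galois.
- by move=> a /=; rewrite lambda_psiK s_pt.
- by move=> x /=; rewrite sN.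
- by move=> x /=; rewrite -iterS iterSr sN.
move=> x Ax /=; have [y Ay ->] := model_frobenius_lift Ax.
rewrite rmorphD rmorphXn point_scalar // opprD addrA.
apply: (int_maxB g_inj dvrO).
  by apply: sigma_max; apply: model_point_int.
by apply: (int_max_uniformizer g_inj dvrO); apply: model_point_int.
Qed.

End Model.
End Lambda.

(** * Finite generation and bounded denominators *)

(** The first coordinates form a principal ideal; [b0] realizes its generator, and subtracting a
    multiple of [b0] leaves a vector with first coordinate 0, handled by induction through [emb]. *)
Lemma pid_submodule_fg (O : idomainType) n (D : set 'rV[O]_n) :
    (forall a : set O, is_ideal a -> exists g, a = principal g) ->
    D 0 -> (forall x y, D x -> D y -> D (x + y)) ->
    (forall c x, D x -> D (c *: x)) ->
  exists m (b : 'I_m -> 'rV[O]_n), (forall i, D (b i)) /\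
    forall x, D x -> exists c : 'I_m -> O, x = \sum_i c i *: b i.
Proof.
move=> pid; elim: n D => [|n IHn] D D0 DD DZ.
  exists 0%N, (fun=> 0); split=> [[]//|x _]; exists (fun=> 0).
  by rewrite big_ord0; apply/rowP => -[].
pose I := [set a | exists2 x, D x & a = x 0 0].
have [h def_I] : exists h, I = principal h.
  apply: pid; split.
  - by exists 0; rewrite ?mxE.
  - move=> _ _ [x Dx ->] [y Dy ->]; exists (x + y); rewrite ?mxE //; exact: DD.
  - by move=> c _ [x Dx ->]; exists (c *: x); rewrite ?mxE //; exact: DZ.
have [b0 Db0 hb0] : I h by rewrite def_I; exists 1; rewrite mul1r.
pose emb (y : 'rV[O]_n) : 'rV[O]_n.+1 :=
  \row_i oapp (fun i' => y 0 i') 0 (unlift ord0 i).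
have embD x y : emb (x + y) = emb x + emb y.
  by apply/rowP => i; rewrite !mxE; case: (unlift ord0 i) => [i'|] /=;
    rewrite ?mxE ?addr0.
have embZ c x : emb (c *: x) = c *: emb x.
  by apply/rowP => i; rewrite !mxE; case: (unlift ord0 i) => [i'|] /=;
    rewrite ?mxE ?mulr0.
have emb0 : emb 0 = 0 by rewrite -(scale0r 0) embZ !scale0r.
have [|||m [b [Db b_gen]]] := IHn (fun y => D (emb y)).
- by rewrite emb0.
- by move=> x y Dx Dy; rewrite embD; apply: DD.
- by move=> c x Dx; rewrite embZ; apply: DZ.
exists m.+1, (fun i => oapp (fun i' => emb (b i')) b0 (unlift ord0 i)).
split=> [i|x Dx]; first by case: (unlift _ _) => [i'|] //=; apply: Db.
have [c x0] : principal h (x 0 0) by rewrite -def_I; exists x.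
pose y := x - c *: b0.
pose y' := \row_i y 0 (lift ord0 i); have yE : y = emb y'.
  apply/rowP => i; rewrite [RHS]mxE.
  case: (unliftP ord0 i) => [i'|] -> /=; first by rewrite [RHS]mxE.
  by rewrite !mxE x0 hb0 subrr.
have Dy : D y.
  by apply: DD => //; rewrite -scaleN1r; apply: (DZ); apply: DZ.
have [|c' def_y] := b_gen y'; first by rewrite -yE.
exists (fun i => oapp c' c (unlift ord0 i)).
rewrite big_ord_recl unlift_none /= -[LHS](subrK (c *: b0)) -/y addrC yE def_y.
congr (_ + _); rewrite (eq_bigr (fun i => c' i *: emb (b i))).
  elim: (index_enum _) => [|i r IHr]; first by rewrite !big_nil.
  by rewrite !big_cons embD embZ IHr.
by move=> i _; rewrite liftK.
Qed.

Section Construction.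
Variables (O : idomainType) (p : set O) (O_dvr : is_dvr p).
Variables (k : finFieldType) (rho : {rmorphism O -> k}) (pi : O).
Hypotheses (def_p : p = principal pi) (dvrO : complete_dvr rho pi).
Variables (K : fieldType) (iota : {rmorphism O -> K}).
Hypothesis iotaP : is_fraction_field iota.
Variables (Ksep : fieldType) (j : {rmorphism K -> Ksep}).
Hypothesis jP : is_separable_closure j.
Variables (E : comPzRingType) (eta : {rmorphism K -> E}).
Hypothesis E_etale : finite_etale eta.

Let f : {rmorphism O -> E} := eta \o iota.
Let g : {rmorphism O -> Ksep} := j \o iota.
Local Notation q := #|k|.
Local Notation "h ^j" := (map_poly j h) (at level 2, format "h ^j").
Local Notation "h ^g" := (map_poly g h) (at level 2, format "h ^g").

Let g_inj : injective g.
Proof. by move=> c d /fmorph_inj/iotaP.1. Qed.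

Let g_pi_neq0 n : g pi ^+ n != 0.
Proof.
by rewrite expf_neq0 // -(rmorph0 g) (inj_eq g_inj) (uniformizer_neq0 dvrO).
Qed.

Let iota_pi_neq0 n : iota pi ^+ n != 0.
Proof.
by rewrite expf_neq0 // -(rmorph0 iota) (inj_eq iotaP.1) (uniformizer_neq0 dvrO).
Qed.

Lemma fraction_clear a : exists m c, iota pi ^+ m * a = iota c.
Proof.
have [c [d [d0 ->]]] := iotaP.2 a.
have [m [u [u_unit def_d]]] := factor_uniformizer dvrO d0.
exists m, (c * u^-1); rewrite def_d !rmorphM rmorphXn invfM.
have u_neq0 : iota u != 0.
  by rewrite -(rmorph0 iota) (inj_eq iotaP.1); apply: contraTneq u_unit => ->;
    rewrite unitr0.
rewrite mulrCA mulVKf ?iota_pi_neq0 //; congr (_ * _).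
by apply: (mulfI u_neq0); rewrite divff // -rmorphM divrr // rmorph1.
Qed.

(** Membership in B[1/pi]. *)
Definition bounded (B : set Ksep) y := exists m, B (g pi ^+ m * y).

Section Bounded.
Variable B : set Ksep.
Hypothesis saB : subalgebra g B.

Lemma bounded_mono m n y : (m <= n)%N -> B (g pi ^+ m * y) -> B (g pi ^+ n * y).
Proof.
move=> le_mn By; rewrite -(subnK le_mn) exprD -mulrA; apply: (sa_mul saB) => //.
by apply: (sa_exp saB); exact: (sa_const saB).
Qed.

Lemma boundedD x y : bounded B x -> bounded B y -> bounded B (x + y).
Proof.
move=> [m Bx] [n By]; exists (m + n)%N; rewrite mulrDr; apply: (sa_add saB).
  by apply: bounded_mono Bx; rewrite leq_addr.
by apply: bounded_mono By; rewrite leq_addl.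
Qed.

Lemma boundedM x y : bounded B x -> bounded B y -> bounded B (x * y).
Proof.
move=> [m Bx] [n By]; exists (m + n)%N; rewrite exprD mulrACA.
exact: (sa_mul saB).
Qed.

Lemma bounded_fraction a : bounded B (j a).
Proof.
have [m [c Ec]] := fraction_clear a; exists m.
have -> : g pi ^+ m * j a = g c by rewrite /= -Ec rmorphM rmorphXn.
exact: (sa_const saB).
Qed.

Lemma bounded_sum (I : Type) (r : seq I) (P : pred I) (F : I -> Ksep) :
  (forall i, P i -> bounded B (F i)) -> bounded B (\sum_(i <- r | P i) F i).
Proof.
move=> F_bd; apply: (big_ind (bounded B)) => //; last exact: boundedD.
by exists 0%N; rewrite mulr0; apply: (sa0 saB).
Qed.

Lemma bounded_in x : B x -> bounded B x.
Proof. by move=> Bx; exists 0%N; rewrite mul1r. Qed.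

Lemma bounded_horner (h : {poly K}) z : B z -> bounded B h^j.[z].
Proof.
move=> Bz; rewrite horner_coef; apply: bounded_sum => i _; rewrite coef_map.
by apply: boundedM; [exact: bounded_fraction | apply/bounded_in/(sa_exp saB)].
Qed.

Lemma bounded_common (I : finType) (y : I -> Ksep) : (forall i, bounded B (y i)) ->
  exists m, forall i, B (g pi ^+ m * y i).
Proof.
move=> /choice[m mP]; exists (\sum_i m i) => i.
by apply: bounded_mono (mP i); rewrite (bigD1 i) //= leq_addr.
Qed.
End Bounded.

(** If u = pi^m clears the denominators of the minimal polynomial, u y is a root of the monic
    polynomial with coefficients u^(n-i) h_i, and for i < n at least one factor u is present. *)
Lemma integral_bounded y : exists m, integralOver g (g pi ^+ m * y).
Proof.
have [h [h_mon hy _]] := min_poly_exists jP y.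
pose n := (size h).-1.
have sh : size h = n.+1.
  by rewrite /n prednK // size_poly_gt0 monic_neq0.
have [m mP] : exists m, forall i : 'I_n, exists c, iota pi ^+ m * h`_i = iota c.
  have /choice[m mP] : forall i : 'I_n,
      exists m, exists c, iota pi ^+ m * h`_i = iota c.
    by move=> i; exact: fraction_clear.
  exists (\sum_i m i) => i; have [c Ec] := mP i.
  exists (pi ^+ (\sum_i m i - m i) * c); rewrite rmorphM rmorphXn -Ec mulrA.
  by rewrite -exprD subnK // (bigD1 i) //= leq_addr.
exists m; set u := g pi ^+ m.
pose P := \poly_(i < n.+1) (u ^+ (n - i) * j h`_i).
apply: (@integral_root_monic _ _ g _ P).
- have P_n : P`_n = 1.
    by rewrite coef_poly ltnSn subnn mul1r /n -lead_coefE (monicP h_mon) rmorph1.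
  have sP : size P = n.+1.
    apply/eqP; rewrite eqn_leq size_poly /= ltnNge; apply/negP => le_P.
    by move/eqP: P_n; rewrite nth_default // eq_sym oner_eq0.
  by rewrite monicE lead_coefE sP P_n.
- rewrite rootE (@horner_coef_wide _ n.+1) ?size_poly //.
  rewrite (eq_bigr (fun i : 'I_n.+1 => u ^+ n * (j h`_i * y ^+ i))).
    rewrite -mulr_sumr; move/rootP: hy.
    rewrite (@horner_coef_wide _ n.+1) ?size_map_poly ?sh //.
    rewrite (eq_bigr (fun i : 'I_n.+1 => j h`_i * y ^+ i)) => [->|i _].
      by rewrite mulr0.
    by rewrite coef_map.
  move=> i _; rewrite coef_poly ltn_ord exprMn.
  have -> : u ^+ n = u ^+ (n - i) * u ^+ i by rewrite -exprD subnK // -ltnS.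
  by ring.
apply/integral_poly => i; rewrite coef_poly; case: ltnP => [|_]; last exact: integral0.
rewrite ltnS leq_eqVlt => /predU1P[->|lt_in].
  rewrite subnn mul1r /n -lead_coefE (monicP h_mon) rmorph1; exact: integral1.
have [c Ec] := mP (Ordinal lt_in).
have -> : u ^+ (n - i) * j h`_i = u ^+ (n - i).-1 * g c.
  rewrite -{1}(@prednK (n - i)) ?subn_gt0 // exprSr -mulrA; congr (_ * _).
  by rewrite /= -Ec rmorphM rmorphXn.
apply: integral_mul; last exact: integral_id.
have saI := integral_subalgebra g.
by do 2!apply: (sa_exp saI); apply: integral_id.
Qed.

(** The points embed [A] in C^r, a quotient of a free module of finite rank; [rel] says that v lifts
    the image of x. The lifts of elements of [A] form a submodule over a principal ideal domain, and
    its generators yield generators of [A]. *)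
Lemma finite_module_points (A : set E) (C : set Ksep) r
    (T : 'I_r -> {rmorphism E -> Ksep}) :
    (forall i, points j eta (T i)) ->
    (forall x, (forall i, T i x = 0) -> x = 0) ->
    subalgebra f A -> finite_module g C ->
    (forall x i, A x -> C (T i x)) ->
  finite_module f A.
Proof.
move=> T_pt T_sep saA [m [e [Ce e_gen]]] AC.
have Tf i c x : T i (f c * x) = g c * T i x by rewrite rmorphM /= T_pt.
pose I := ('I_r * 'I_m)%type.
pose rel (v : 'rV[O]_#|{: I}|) x := A x /\ forall i,
  T i x = \sum_l g (v 0 (enum_rank ((i, l) : I))) * e l.
have [pid _ _] := O_dvr.
have [|||n [b [Db b_gen]]] := @pid_submodule_fg _ _ (fun v => exists x, rel v x) pid.
- exists 0; split=> [|i]; first exact: (sa0 saA).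
  by rewrite rmorph0 big1 // => l _; rewrite mxE [X in X * _](rmorph0 g) mul0r.
- move=> v w [x [Ax xE]] [y [Ay yE]]; exists (x + y); split=> [|i].
    exact: (sa_add saA).
  rewrite rmorphD xE yE -big_split /=; apply: eq_bigr => l _.
  by rewrite mxE -mulrDl -(rmorphD g).
- move=> c v [x [Ax xE]]; exists (f c * x); split=> [|i].
    exact: (sa_scale saA).
  rewrite Tf xE mulr_sumr; apply: eq_bigr => l _.
  by rewrite mxE mulrA -(rmorphM g).
have /choice[x xP] := Db.
exists n, x; split=> [t|y Ay]; first exact: (xP t).1.
have /choice[c cP] : forall i, exists c : 'I_m -> O, T i y = \sum_l g (c l) * e l.
  by move=> i; apply: e_gen; apply: AC.
have [|a def_a] := b_gen (\row_t c (enum_val t).1 (enum_val t).2).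
  exists y; split=> // i; rewrite cP; apply: eq_bigr => l _.
  by rewrite mxE enum_rankK.
exists a; apply: subr0_eq; apply: T_sep => i; apply/eqP.
rewrite rmorphB subr_eq0 rmorph_sum cP; apply/eqP.
rewrite (eq_bigr (fun t => \sum_l g (a t * b t 0 (enum_rank ((i, l) : I))) * e l)).
  rewrite exchange_big /=; apply: eq_bigr => l _; rewrite -mulr_suml.
  congr (_ * _); rewrite -(rmorph_sum g); congr (g _).
  have /rowP/(_ (enum_rank ((i, l) : I))) := def_a.
  rewrite mxE enum_rankK /= => ->; rewrite summxE.
  by apply: eq_bigr => t _; rewrite mxE.
move=> t _; rewrite Tf (xP t).2 mulr_sumr; apply: eq_bigr => l _.
by rewrite mulrA -(rmorphM g).
Qed.

End Construction.

(** * Sufficiency: the model *)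

Section LambdaModel.
Variables (O : idomainType) (p : set O) (O_dvr : is_dvr p).
Variables (k : finFieldType) (rho : {rmorphism O -> k}) (pi : O).
Hypotheses (def_p : p = principal pi) (dvrO : complete_dvr rho pi).
Variables (K : fieldType) (iota : {rmorphism O -> K}).
Hypothesis iotaP : is_fraction_field iota.
Variables (Ksep : fieldType) (j : {rmorphism K -> Ksep}).
Hypothesis jP : is_separable_closure j.
Variables (E : comPzRingType) (eta : {rmorphism K -> E}).
Hypothesis E_etale : finite_etale eta.
Variable psi : {rmorphism E -> E}.
Local Notation q := #|k|.
Hypothesis psiP : lambda_structure (eta \o iota) p q setT psi.

Let f : {rmorphism O -> E} := eta \o iota.
Let g : {rmorphism O -> Ksep} := j \o iota.
Local Notation "h ^j" := (map_poly j h) (at level 2, format "h ^j").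
Local Notation "h ^g" := (map_poly g h) (at level 2, format "h ^g").

Let g_pi_neq0 : g pi != 0.
Proof.
by rewrite /= fmorph_eq0 -(rmorph0 iota) (inj_eq iotaP.1)
  (uniformizer_neq0 dvrO).
Qed.

Let psiK := lambda_psiK iotaP psiP.

Section Model.
Variable N : nat.
Hypothesis psiN : forall x, iter N psi (iter N psi x) = iter N psi x.
Variables (z : Ksep) (C : set Ksep).
Hypotheses (z_teich : teichmuller k z) (saC : subalgebra g C).
Hypotheses (finC : finite_module g C) (Cz : C z).
Hypothesis z_unr : forall s x, points j eta s -> exists h : {poly K},
  s (iter N psi x) = h^j.[z] /\ s (iter N psi (psi x)) = h^j.[z ^+ q].
Hypothesis C_bounded : forall s x, points j eta s -> bounded pi iota j C (s x).

(** An idempotent endomorphism commuting with [psi]: its image is the periodic part of [E], and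
    psi^N kills every x - eps x. *)
Let eps := rmorph_iter psi N.
Let epsE x : eps x = iter N psi x. Proof. exact: rmorph_iterE. Qed.
Let epsK x : eps (eps x) = eps x. Proof. by rewrite !epsE psiN. Qed.
Let eps_psi x : eps (psi x) = psi (eps x).
Proof. by rewrite !epsE -iterSr iterS. Qed.

Let Z : set Ksep := [set y | exists h : {poly O}, y = h^g.[z]].

Let saZ : subalgebra g Z.
Proof.
split.
- by exists 1; rewrite rmorph1 hornerC.
- by move=> _ _ [h ->] [h' ->]; exists (h - h'); rewrite rmorphB !hornerE.
- by move=> _ _ [h ->] [h' ->]; exists (h * h'); rewrite rmorphM !hornerE.
- by move=> c _ [h ->]; exists (c *: h); rewrite map_polyZ !hornerE.
Qed.

Let ZC : Z `<=` C.
Proof.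
move=> _ [h ->]; rewrite horner_coef; apply: (sa_sum saC) => i _.
by rewrite coef_map; apply: (sa_scale saC); apply: (sa_exp saC).
Qed.

(** [z_unr] provides some polynomial over [K]; it agrees with the given [h] at [z], hence also at
    the conjugate z^q. *)
Let Z_frob s x (h : {poly O}) : points j eta s ->
  s (eps x) = h^g.[z] -> s (eps (psi x)) = h^g.[z ^+ q].
Proof.
move=> s_pt; have [h' [E1 E2]] := z_unr x s_pt; rewrite !epsE E1 E2 => Eh.
have gE y : h^g.[y] = (map_poly iota h)^j.[y] by rewrite map_poly_comp.
rewrite gE in Eh; apply/eqP; rewrite gE -subr_eq0 -hornerN -hornerD -rmorphB.
apply: (teichmuller_conjugate dvrO iotaP jP z_teich).
by rewrite rootE rmorphB hornerD hornerN Eh subrr.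
Qed.

(* The unramified part eps x of x is required to be integral over O[z]; the
   increasing powers of pi make psi a Frobenius lift on the complementary
   nilpotent part. *)
Definition model : set E := [set x | forall s, points j eta s ->
  Z (s (eps x)) /\ forall n, adic g C pi n.+1 (s (iter n psi (x - eps x)))].

Let iter_psiD n x y : iter n psi (x - y) = iter n psi x - iter n psi y.
Proof. by elim: n => //= n ->; rewrite rmorphB. Qed.

Let point_iter s n : points j eta s -> points j eta (s \o rmorph_iter psi n).
Proof. by move=> s_pt; apply: points_iter psiK _ _ s_pt. Qed.

Lemma model_bounded s x : points j eta s -> model x -> C (s x).
Proof.
move=> s_pt mx; have [/ZC C_eps /(_ 0) ad] := mx s s_pt.
rewrite -[x](subrK (eps x)) rmorphD; apply: (sa_add saC) => //.
exact: (adic_sub saC ad).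
Qed.

Lemma model_iter_bounded s n x : points j eta s -> model x ->
  C (s (iter n psi x)).
Proof.
move=> s_pt mx; rewrite -rmorph_iterE.
exact: model_bounded (point_iter n s_pt) mx.
Qed.

Lemma model_subalgebra : subalgebra f model.
Proof.
have fE s c x : points j eta s -> s (f c * x) = g c * s x by apply: point_scalar.
have eps_f c x : eps (f c * x) = f c * eps x by rewrite rmorphM /= rmorph_iterK.
have it_f n c x : iter n psi (f c * x) = f c * iter n psi x.
  by rewrite -!rmorph_iterE rmorphM /= rmorph_iterK.
split.
- move=> s s_pt; rewrite !rmorph1; split=> [|n]; first exact: (sa1 saZ).
  by rewrite subrr -rmorph_iterE !rmorph0; apply: (adic0 saC).
- move=> x y mx my s s_pt.
  have [Zx ax] := mx s s_pt; have [Zy ay] := my s s_pt.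
  rewrite !rmorphB; split=> [|n]; first exact: (sa_sub saZ).
  rewrite opprD addrACA -opprD iter_psiD rmorphB; exact: (adicB saC).
- move=> x y mx my s s_pt.
  have [Zx ax] := mx s s_pt; have [Zy ay] := my s s_pt.
  rewrite !rmorphM; split=> [|n]; first exact: (sa_mul saZ).
  have -> : x * y - eps x * eps y = (x - eps x) * y + eps x * (y - eps y) by ring.
  have Cx : C (s (iter n psi (eps x))).
    by rewrite -rmorph_iterE; apply: ZC; exact: (mx _ (point_iter n s_pt)).1.
  have -> u v u' v' : iter n psi (u * v + u' * v') =
      iter n psi u * iter n psi v + iter n psi u' * iter n psi v'.
    by rewrite -!rmorph_iterE rmorphD !rmorphM.
  rewrite rmorphD !rmorphM; apply: (adicD saC).
    by apply: (adicMr saC) => //; apply: model_iter_bounded.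
  exact: (adicMl saC).
- move=> c x mx s s_pt; have [Zx ax] := mx s s_pt.
  rewrite eps_f fE //; split=> [|n]; first exact: (sa_scale saZ).
  rewrite -mulrBr it_f fE //; apply: (adicMl saC) => //; exact: (sa_const saC).
Qed.

Lemma model_psi x : model x -> model (psi x).
Proof.
move=> mx s s_pt; have [[h Zx] ax] := mx s s_pt; split=> [|n].
  exists (h \Po 'X^q); rewrite (Z_frob s_pt Zx) map_comp_poly map_polyXn.
  by rewrite horner_comp hornerXn.
rewrite eps_psi -rmorphB -iterSr; exact: (adicW saC) (ax n.+1).
Qed.

Lemma adic_cancel n y : adic g C pi n.+1 (g pi * y) -> adic g C pi n y.
Proof.
move=> [b Cb E1]; exists b => //; apply: (mulfI g_pi_neq0).
by rewrite E1 mulrA exprS.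
Qed.

(** Put w = psi x - x^q and t = s psi^n. On the periodic part, w becomes h(z^q) - h(z)^q, divisible
    by [pi] in O[z]. On the complement it becomes t(psi(x - eps x)) minus t(x)^q - t(eps x)^q. Both
    terms have exponent n+2: the first is the condition at n+1, the second the gain of a q-th power
    over the condition at n. Dividing by [pi] leaves the required n+1. *)
Lemma model_frobenius_lift_mod x : model x ->
  exists2 y, model y & psi x - x ^+ q = f pi * y.
Proof.
move=> mx; pose w := psi x - x ^+ q.
have w_div : f pi * (eta (iota pi)^-1 * w) = w.
  rewrite mulrA /= -rmorphM divff ?rmorph1 ?mul1r //.
  by rewrite -(rmorph0 iota) (inj_eq iotaP.1) (uniformizer_neq0 dvrO).
exists (eta (iota pi)^-1 * w); last by rewrite w_div.
set y := _ * w in w_div *; move=> s s_pt.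
have fE c u t : points j eta t -> t (f c * u) = g c * t u by apply: point_scalar.
have eps_f c u : eps (f c * u) = f c * eps u by rewrite rmorphM /= rmorph_iterK.
split=> [|n].
  have [[h Zx] _] := mx s s_pt.
  have Zz : Z z by exists 'X; rewrite map_polyX hornerX.
  have [b Zb] := horner_expr_card dvrO h saZ Zz.
  have E1 : s (eps w) = s (eps (psi x)) - s (eps x) ^+ q.
    by rewrite /w !rmorphB !rmorphXn.
  rewrite -(Z_frob s_pt Zx) -Zx -E1 -w_div eps_f fE // expr1 => /(mulfI g_pi_neq0) -> //.
apply: adic_cancel; rewrite -fE // -rmorph_iterE.
have -> : f pi * rmorph_iter psi n (y - eps y) = rmorph_iter psi n (w - eps w).
  rewrite -w_div eps_f -mulrBr [RHS]rmorphM; congr (_ * _).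
  by rewrite /= rmorph_iterK.
set t := s \o rmorph_iter psi n; have t_pt : points j eta t by apply: point_iter.
have -> : s (rmorph_iter psi n (w - eps w)) =
    t (psi (x - eps x)) - (t x ^+ q - t (eps x) ^+ q).
  rewrite /w [in LHS](rmorphB eps) eps_psi -!rmorphXn -!rmorphB /=.
  congr (s _); congr (rmorph_iter psi n _); rewrite !rmorphB rmorphXn; ring.
apply: (adicB saC).
  have := (mx s s_pt).2 n.+1; rewrite iterSr /t /=.
  by rewrite rmorph_iterE.
apply: (adic_expr_card saC dvrO); first exact/ZC/(mx t t_pt).1.
have -> : t x - t (eps x) = s (iter n psi (x - eps x)).
  by rewrite -rmorphB /t /= rmorph_iterE.
exact: (mx s s_pt).2.
Qed.

Lemma model_span x : exists M, model (f (pi ^+ M) * x).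
Proof.
have [r [T [T_pt T_all]]] := etale_points_finite j E_etale.
have Zz : Z z by exists 'X; rewrite map_polyX hornerX.
have [m1 m1P] := bounded_common saZ (y := fun i => T i (eps x)) (pi := pi) (fun i =>
  let: ex_intro h (conj Eh _) := z_unr x (T_pt i) in
  eq_ind_r (bounded pi iota j Z) (bounded_horner dvrO iotaP saZ h Zz)
    (etrans (congr1 (T i) (epsE x)) Eh)).
pose y (t : 'I_r * 'I_N) := T t.1 (iter t.2 psi (x - eps x)).
have [m2 m2P] := bounded_common saC (y := y) (pi := pi)
  (fun t => C_bounded _ (T_pt t.1)).
(* [m1] clears denominators over O[z], [m2] those over [C], and [N] supplies the factor pi^(n+1) for
   n < N; for larger n the value is 0. *)
exists (m1 + (m2 + N))%N => s s_pt; have [i sE] := T_all s s_pt.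
set M := (_ + _)%N.
have fE c u : s (f c * u) = g c * s u by apply: point_scalar.
have eps_f c u : eps (f c * u) = f c * eps u by rewrite rmorphM /= rmorph_iterK.
have it_f n c u : iter n psi (f c * u) = f c * iter n psi u.
  by rewrite -!rmorph_iterE rmorphM /= rmorph_iterK.
rewrite eps_f fE (rmorphXn g) sE; split=> [|n].
  by apply: bounded_mono saZ _ _ _ _ (m1P i); rewrite leq_addr.
rewrite -mulrBr it_f fE (rmorphXn g) sE.
have [lt_nN|le_Nn] := ltnP n N; last first.
  rewrite -(subnK le_Nn) iterD -!epsE rmorphB epsK subrr.
  by rewrite -rmorph_iterE !rmorph0 mulr0; apply: (adic0 saC).
have le_nM : (n.+1 <= M)%N by rewrite (leq_trans lt_nN) // /M addnA leq_addl.
rewrite -(subnKC le_nM) exprD -mulrA; apply: adic_uniformizer.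
apply: bounded_mono saC _ _ _ _ (m2P (i, Ordinal lt_nN)).
by rewrite /M addnA -addnBA // (leq_trans _ (leq_addr _ _)) // leq_addl.
Qed.

Lemma model_integral : integral_lambda_model p q iota eta psi model.
Proof.
have [r [T [T_pt T_all]]] := etale_points_finite j E_etale.
have T_sep x : (forall i, T i x = 0) -> x = 0.
  move=> Tx0; apply: (etale_separated jP E_etale) => s /T_all[i ->]; exact: Tx0.
have saM := model_subalgebra.
have [tfE _ psi_lin _] := psiP.
have tfM : torsion_free f model by move=> c x _; apply: tfE.
have finM : finite_module f model.
  apply: (finite_module_points O_dvr T_pt T_sep saM finC) => x i mx.
  exact: model_bounded.
split=> //.
- by split=> //; apply: (finite_flat saM dvrO finM tfM).
- move=> x; have [M mMx] := model_span x.
  exists 1%N, (fun=> (iota pi ^+ M)^-1), (fun=> f (pi ^+ M) * x).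
  split=> //; rewrite big_ord1 mulrA /= -rmorphM rmorphXn mulVf ?rmorph1 ?mul1r //.
  by rewrite expf_neq0 // -(rmorph0 iota) (inj_eq iotaP.1) (uniformizer_neq0 dvrO).
- split=> //; first exact: model_psi.
    by move=> c x _; apply: psi_lin.
  move=> x /model_frobenius_lift_mod[y my ->].
  exists 1%N, (fun=> pi), (fun=> y); split=> //; last by rewrite big_ord1.
  by move=> _; rewrite def_p; exists 1; rewrite mul1r.
Qed.

End Model.

Lemma frobenius_graph_seq (s : seq (Ksep * Ksep)) :
    (forall xy, xy \in s -> frobenius_graph k j xy) ->
  exists2 z, teichmuller k z & forall xy, xy \in s -> exists h : {poly K},
    xy.1 = h^j.[z] /\ xy.2 = h^j.[z ^+ q].
Proof.
elim: s => [_|xy s IHs s_unr]; first by exists 1 => //; exists 0%N; rewrite expr1n.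
have [|z z_t zP] := IHs; first by move=> uv s_uv; apply: s_unr; rewrite inE s_uv orbT.
have [z' z'_t [h' [E1 E2]]] : frobenius_graph k j xy.
  by apply: s_unr; rewrite inE eqxx.
have [w w_t [u [u' [zu zqu z'u z'qu]]]] :=
  teichmuller_common dvrO iotaP jP z_t z'_t.
exists w => // uv; rewrite inE => /predU1P[->|/zP[h [-> ->]]].
  exists (h' \Po u'); rewrite E1 E2 map_comp_poly !horner_comp.
  by rewrite -z'u -z'qu.
by exists (h \Po u); rewrite map_comp_poly !horner_comp -zu -zqu.
Qed.

(** For any point s, the point s psi^N lies in S_unr. By (1) its values lie in the unramified field,
    and by (2) the automorphism of [frobenius_exists], known on Teichmueller elements, sends its
    value at x to its value at psi x. The pair of values is thus in [frobenius_graph], and finitely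
    many such pairs share one [z]. *)
Lemma model_of_unramified :
    (forall (sigma : {rmorphism Ksep -> Ksep}) (s : {rmorphism E -> Ksep}),
       inertia_elt iota j sigma -> points_unr p j eta psi s -> sigma \o s =1 s) ->
    (forall (sigma : {rmorphism Ksep -> Ksep}) (s : {rmorphism E -> Ksep}),
       frobenius_elt iota j q sigma -> points_unr p j eta psi s ->
       sigma \o s =1 s \o psi) ->
  exists A, integral_lambda_model p q iota eta psi A.
Proof.
move=> unr_inertia unr_frob.
have [N N_gt0 psiN] := psi_idempotent_power jP E_etale psiK.
have [r [T [T_pt T_all]]] := etale_points_finite j E_etale.
have [d [e e_gen]] := etale_span E_etale.
have [sigma sigma_frob sigmaW] := frobenius_exists dvrO iotaP jP.
have graphE s x : points j eta s ->
    frobenius_graph k j (s (iter N psi x), s (iter N psi (psi x))).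
  move=> s_pt; pose s' : {rmorphism E -> Ksep} := s \o rmorph_iter psi N.
  have s'_unr : points_unr p j eta psi s'.
    apply/(points_unrP O_dvr def_p dvrO iotaP j psiP s' N_gt0 psiN).
    split; first exact: (points_iter psiK).
    by move=> y /=; rewrite !rmorph_iterE psiN.
  have s'E y : s' y = s (iter N psi y) by rewrite /= rmorph_iterE.
  have [y xy] : exists y, frobenius_graph k j (s' x, y).
    apply: (inertia_fixed dvrO iotaP jP) => tau tau_inertia.
    exact: (unr_inertia tau s').
  have [z z_t [h /= [Ez Ey]]] := xy.
  suff Ey' : y = s' (psi x) by rewrite -!s'E -Ey'.
  have /= <- := unr_frob sigma s' sigma_frob s'_unr x.
  rewrite Ez -horner_map /= sigmaW // Ey.
  rewrite -map_poly_comp; congr (_.[_]).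
  by apply: eq_map_poly => a /=; rewrite sigma_frob.1.2.
pose I := ('I_r * 'I_d)%type.
pose pt (t : I) := (T t.1 (iter N psi (e t.2)), T t.1 (iter N psi (psi (e t.2)))).
have [|z z_t zP] := @frobenius_graph_seq [seq pt t | t : I].
  by move=> _ /codomP[t ->]; apply: graphE.
have /choice[h hP] : forall t : I, exists h : {poly K},
    T t.1 (iter N psi (e t.2)) = h^j.[z] /\
    T t.1 (iter N psi (psi (e t.2))) = h^j.[z ^+ q].
  by move=> t; have [h hP] := zP (pt t) (codom_f pt t); exists h.
have /choice[m mP] : forall t : I, exists m,
    integralOver g (g pi ^+ m * T t.1 (e t.2)).
  by move=> t; apply: (integral_bounded dvrO iotaP jP).
(* [C] contains [z] and integral multiples of the values of all points on a spanning family, so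
   every value of a point lies in C[1/pi]. *)
have [|C [saC finC CP]] := @finite_adjoin_seq _ _ g
    (z :: [seq g pi ^+ m t * T t.1 (e t.2) | t : I]).
  move=> y; rewrite inE => /predU1P[->|/codomP[t ->]]; last exact: mP.
  by apply: teichmuller_int; exact: z_t.
exists (model N z C); apply: model_integral => //.
- by apply: CP; rewrite inE eqxx.
- move=> s x s_pt; have [i sE] := T_all s s_pt; have [a ->] := e_gen x.
  exists (\sum_l a l *: h (i, l)); rewrite !sE.
  have psi_sum F : psi (\sum_l eta (a l) * F l) = \sum_l eta (a l) * psi (F l).
    by rewrite rmorph_sum; apply: eq_bigr => l _; rewrite rmorphM psiK.
  have T_sum F : T i (iter N psi (\sum_l eta (a l) * F l)) =
      \sum_l j (a l) * T i (iter N psi (F l)).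
    rewrite -rmorph_iterE !rmorph_sum; apply: eq_bigr => l _.
    by rewrite !rmorphM rmorph_iterK // T_pt rmorph_iterE.
  rewrite psi_sum !T_sum rmorph_sum !horner_sum.
  by split; apply: eq_bigr => l _; have /= [H1 H2] := hP (i, l);
    rewrite /= map_polyZ hornerZ -?H1 -?H2.
- move=> s x s_pt; have [i sE] := T_all s s_pt; have [a ->] := e_gen x.
  rewrite sE rmorph_sum; apply: (bounded_sum saC) => l _.
  rewrite rmorphM T_pt; apply: (boundedM saC).
    exact: (bounded_fraction dvrO iotaP saC).
  exists (m (i, l)); apply: CP; rewrite inE; apply/orP; right.
  exact: (codom_f (fun t : I => g pi ^+ m t * T t.1 (e t.2)) (i, l)).
Qed.

End LambdaModel.

Theorem theorem1p1
    (O : idomainType) (p : set O)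
    (O_dvr : is_dvr p) (O_complete : adically_complete p)
    (k : finFieldType) (rho : {rmorphism O -> k}) (rhoP : is_residue_map p rho)
    (K : fieldType) (iota : {rmorphism O -> K}) (iotaP : is_fraction_field iota)
    (Ksep : fieldType) (j : {rmorphism K -> Ksep})
    (jP : is_separable_closure j)
    (E : comPzRingType) (eta : {rmorphism K -> E}) (E_etale : finite_etale eta)
    (psi : {rmorphism E -> E})
    (psiP : lambda_structure (eta \o iota) p #|k| setT psi) :
  (exists A : set E, integral_lambda_model p #|k| iota eta psi A) <->
  (forall (sigma : {rmorphism Ksep -> Ksep}) (s : {rmorphism E -> Ksep}),
     inertia_elt iota j sigma -> points_unr p j eta psi s ->
     sigma \o s =1 s) /\
  (forall (sigma : {rmorphism Ksep -> Ksep}) (s : {rmorphism E -> Ksep}),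
     frobenius_elt iota j #|k| sigma -> points_unr p j eta psi s ->
     sigma \o s =1 s \o psi).
Proof.
have [pi def_p dvrO] := dvr_uniformizer O_dvr O_complete rhoP.
split=> [[A A_model]|[unr_inertia unr_frob]].
  split=> sigma s sigma_P s_unr.
    exact: (model_inertia O_dvr def_p dvrO iotaP jP E_etale psiP A_model).
  exact: (model_frobenius O_dvr def_p dvrO iotaP jP E_etale psiP A_model).
exact: (model_of_unramified O_dvr def_p dvrO iotaP jP E_etale psiP).
Qed.
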